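(* Let $f:(0,\infty)\to\mathbb{R}$ be a function in $L^1(0,\infty)$ which is locally absolutely continuous on $(0,\infty)$ and whose derivative $f'$ is summable in a neighborhood of infinity (hence $f'\in L^1(x,\infty)$ for every $x>0$). Let $p\in[0,1)$. Assume that $$\lim_{s\to 0^+} s^p f(s)=\ell\in\mathbb{R}$$ and $$\limsup_{x\to 0^+} x^p\int_x^\infty |f'(s)|\,ds<\infty.$$ Then $$\lim_{\lambda\to\infty}\lambda^{1-p}\hat f(\lambda)=\ell\,\mathfrak{n}(p).$$
   Context: The half Fourier transform of $f$ is $\hat f(\lambda)=\int_0^\infty e^{-i\lambda s}f(s)\,ds$ for $\lambda>0$. For $p\in[0,1)$, $\mathfrak{n}(p)=-i\,e^{\frac{ip\pi}{2}}\,\Gamma(1-p)$, where $\Gamma(x)=\int_0^\infty s^{x-1}e^{-s}\,ds$ is the Euler Gamma function. ''Locally absolutely continuous on $(0,\infty)$'' means absolutely continuous on every compact subinterval of $(0,\infty)$. *)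

(* Defs.v *)
(* MathComp-Analysis, with the complex numbers R[i] of mathcomp-real-closed. *)
From HB Require Import structures.
From mathcomp Require Import all_boot all_order all_algebra.
From mathcomp Require Import complex.
From mathcomp Require Import all_classical all_reals all_analysis.

Set Implicit Arguments.
Unset Strict Implicit.
Unset Printing Implicit Defensive.

Import Order.TTheory GRing.Theory Num.Theory.
Import numFieldNormedType.Exports.

Local Open Scope classical_set_scope.
Local Open Scope ring_scope.
Local Open Scope complex_scope.

Definition abs_continuous_on (R : realType) (a b : R) (f : R -> R) : Prop :=
  forall e : R, 0 < e -> exists2 d : R, 0 < d &
    forall (n : nat) (x y : 'I_n -> R),
      (forall i, [/\ a <= x i, x i < y i & y i <= b]) ->
      trivIset setT (fun i => `]x i, y i[%classic) ->
      \sum_(i < n) (y i - x i) < d ->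
      \sum_(i < n) `|f (y i) - f (x i)| < e.

Definition loc_abs_continuous_pos (R : realType) (f : R -> R) : Prop :=
  forall a b : R, 0 < a -> a < b -> abs_continuous_on a b f.

Definition Gamma (R : realType) (x : R) : R :=
  \int[@lebesgue_measure R]_(s in `]0, +oo[) (s `^ (x - 1) * expR (- s)).

Definition cexp (R : realType) (z : R[i]) : R[i] :=
  (expR (complex.Re z))%:C * (cos (complex.Im z) +i* sin (complex.Im z)).

(* Meaningful when the real and imaginary parts of g are both integrable on D;
   a nonintegrable part contributes the junk value of Rintegral. *)
Definition Cintegral (R : realType) (D : set R) (g : R -> R[i]) : R[i] :=
  (\int[@lebesgue_measure R]_(s in D) complex.Re (g s))
    +i* (\int[@lebesgue_measure R]_(s in D) complex.Im (g s)).

Definition half_fourier (R : realType) (f : R -> R) (lambda : R) : R[i] :=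
  Cintegral `]0, +oo[
    (fun s => cexp (- ('i * lambda%:C * s%:C)) * (f s)%:C).

Definition nfrak (R : realType) (p : R) : R[i] :=
  - 'i * cexp ('i * p%:C * pi%:C / 2) * (Gamma (1 - p))%:C.

(* Main.v *)
(* Write [q = 1 - p] and compare [f] with [l m(s)], [m(s) = s^(-p) e^(-s)].  The
   transform of [m] is explicit: an integration by parts turns the derivative
   in [x] of [int m(s) e^(-ixs) ds] into a linear differential equation, whose
   solution is [Gamma(q) (1 + x^2)^(-q/2) e^(-i q atan x)], and [x^q] times it
   tends to [Gamma(q) e^(-i q pi/2) = nfrak p].  The remainder [r = f - l m]
   satisfies [s^p r(s) -> 0]; cut its transform at [u = T/x].  On [0, u] the
   contribution to [x^q r^(x)] is small because [r(s) = o(s^(-p))].  On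
   [u, +oo[ an integration by parts leaves [x^(-p) r(u)], which is small, and
   [x^(-p) int_u^oo |r'| = O(T^(-p))], which is small for large [T] when [p > 0];
   when [p = 0], [r'] is integrable on [0, +oo[ and the Riemann-Lebesgue lemma
   applies instead.

   Integration by parts needs the fundamental theorem of calculus for an
   absolutely continuous [f]: its variation [V] and [V + f] are nondecreasing and
   absolutely continuous, so their Stieltjes measures are dominated by Lebesgue
   measure, and Radon-Nikodym together with Lebesgue differentiation identifies
   the densities with the derivatives.

   Both real and imaginary parts of the transforms are integrals against
   [cos (x s + phi)], with [phi = 0] and [phi = pi / 2]. *)
Require Import Defs.
From HB Require Import structures.
From mathcomp Require Import all_boot all_order all_algebra.
From mathcomp Require Import complex.
From mathcomp Require Import all_classical all_reals all_analysis.
From mathcomp Require Import measurable_realfun ring lra.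

Set Implicit Arguments.
Unset Strict Implicit.
Unset Printing Implicit Defensive.

Import Order.TTheory GRing.Theory Num.Theory.
Import numFieldNormedType.Exports.

Local Open Scope classical_set_scope.
Local Open Scope ring_scope.


(** * Absolute continuity and total variation *)

Section ac_lists.
Context {R : realType}.
Implicit Types (f : R -> R) (a b x y : R) (p q : R * R) (L : seq (R * R)).

(** The factor [e^(-s)] leaves the behaviour of the model at 0 unchanged and makes it integrable at
    infinity, which [s^(-p)] alone is not; subtracting [l m] reduces the statement to the limit
    value 0. The order of the choices matters: [T] depends only on the accuracy, [p] and the tail
    constant; the bound on [s^p r(s)] is then taken small against [T^q / q]; only then does [x]
    grow. For [p = 0] the bound [O(T^(-p))] is small for no [T], hence the separate route. Three
    obstacles shape the rest. The hypothesis on the tail concerns [derive1 f], whose measurability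
    is unclear, so all computations use another representative, linked to it by an inequality
    between tail integrals. The boundary term at infinity in the integration by parts is removed
    along a sequence of points where the integrable [f] is small. Absolute continuity of a function
    speaks of finite families of intervals, that of a measure speaks of null sets; outer regularity
    and dyadic exhaustion of open sets connect them. *)

Definition apart p q := (p.2 <= q.1) || (q.2 <= p.1).
Definition in_segment a b p := [&& a <= p.1, p.1 <= p.2 & p.2 <= b].
Definition total_length L := \sum_(p <- L) (p.2 - p.1).
Definition total_increment f L := \sum_(p <- L) (f p.2 - f p.1).
Definition list_variation f L := \sum_(p <- L) `|f p.2 - f p.1|.

(** With lists of closed, possibly degenerate intervals, replacing one interval by the cells of a
    partition is a concatenation. The weak inequality [<= e] survives the passage to a supremum over
    partitions. *)
Definition list_ac a b f := forall e, 0 < e -> exists2 d, 0 < d &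
  forall L, all (in_segment a b) L -> pairwise apart L ->
    total_length L < d -> list_variation f L <= e.

Lemma sum_filter_nondegenerate a b (F : R * R -> R) L :
  (forall x, F (x, x) = 0) -> all (in_segment a b) L ->
  \sum_(p <- [seq p <- L | p.1 < p.2]) F p = \sum_(p <- L) F p.
Proof.
move=> F0 abL; rewrite big_filter [RHS](bigID (fun p => p.1 < p.2))/=.
rewrite [X in _ + X]big_seq_cond [X in _ + X]big1 ?addr0// => -[x y] /=.
move=> /andP[/(allP abL)/and3P[/= _ xy _]]; rewrite -leNgt => yx.
by have -> : y = x by apply/eqP; rewrite eq_le xy yx.
Qed.

Lemma abs_continuous_on_list_ac a b f : abs_continuous_on a b f -> list_ac a b f.
Proof.
move=> acf e e0; have [d d0 acd] := acf _ e0; exists d => // L abL apL Ld.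
(* [abs_continuous_on] admits only nondegenerate intervals; dropping the others changes neither
   sum. *)
pose K := [seq p <- L | p.1 < p.2].
have KL : subseq K L by exact: filter_subseq.
have apK : pairwise apart K by exact: subseq_pairwise KL apL.
pose X (i : 'I_(size K)) := (nth (0, 0) K i).1.
pose Y (i : 'I_(size K)) := (nth (0, 0) K i).2.
rewrite /list_variation -(@sum_filter_nondegenerate a b)//; last first.
  by move=> x; rewrite /= subrr normr0.
rewrite (big_nth (0, 0)) big_mkord ltW//; apply: (acd _ X Y).
- move=> i; have : nth (0, 0) K i \in K by exact: mem_nth.
  rewrite mem_filter => /andP[XY /(allP abL)/and3P[? _ ?]].
  by split.
- have H (i j : 'I_(size K)) : (i < j)%N -> `]X i, Y i[%classic `&` `]X j, Y j[ = set0.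
    move=> ij; apply/seteqP; split=> // z []; rewrite /= !in_itv/=.
    move=> /andP[xi yi] /andP[xj yj].
    have /pairwiseP := apK => /(_ (0, 0) i j (ltn_ord i) (ltn_ord j) ij).
    move=> /orP[h|h].
      by have := lt_trans (lt_le_trans yi h) xj; rewrite ltxx.
    by have := lt_trans (lt_le_trans yj h) xi; rewrite ltxx.
  move=> i j _ _ [z ijz]; apply: contrapT => /eqP.
  rewrite -val_eqE neq_ltn => /orP[/H h|/H h].
    by rewrite h in ijz.
  by rewrite setIC h in ijz.
- rewrite -(big_mkord xpredT (fun i => (nth (0, 0) K i).2 - (nth (0, 0) K i).1)).
  rewrite -(big_nth (0, 0) xpredT (fun p => p.2 - p.1)).
  by rewrite (@sum_filter_nondegenerate a b)//= => x; rewrite subrr.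
Qed.

Definition cells x s : seq (R * R) := pairmap pair x s.

Lemma variation_cells x y f s : itv_partition x y s ->
  variation x y f s = list_variation f (cells x s).
Proof.
move=> xys; rewrite variation_zip// /list_variation /cells.
elim: s x {xys} => [|z s ih] x /=; first by rewrite !big_nil.
by rewrite !big_cons /= ih.
Qed.

Lemma total_length_cells x y s : last x s = y ->
  total_length (cells x s) = y - x.
Proof.
rewrite /total_length /cells; elim: s x => [|z s ih] x /=.
  by move=> ->; rewrite big_nil subrr.
by move=> zy; rewrite big_cons/= (ih _ zy) addrC subrKA.
Qed.

Lemma path_cells x s : path <%R x s ->
  all (in_segment x (last x s)) (cells x s) && pairwise apart (cells x s).
Proof.
rewrite /cells; elim: s x => [//|z s ih] x /= /andP[xz zs].
have /andP[sl ap] := ih _ zs.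
have zl : z <= last z s.
  elim: s z zs {ih sl ap xz} => //= u s ih z /andP[zu us].
  by rewrite (le_trans (ltW zu))// ih.
rewrite /in_segment/= lexx (ltW xz) zl/= ap andbT; apply/andP; split.
  apply: sub_all sl => p /and3P[zp pp pl]; apply/and3P; split => //.
  by rewrite (le_trans (ltW xz)).
by apply: sub_all sl => p /and3P[zp pp pl]; rewrite /apart/= zp.
Qed.

Lemma apart_cell x y p q : in_segment x y p -> apart (x, y) q -> apart p q.
Proof.
move=> /and3P[xp pp py] /orP[/= h|/= h]; rewrite /apart.
  by rewrite (le_trans py).
by rewrite (le_trans h xp) orbT.
Qed.

Lemma apartC p q : apart p q = apart q p.
Proof. by rewrite /apart orbC. Qed.

(* Cells of finer and finer partitions replace the intervals of [L] one at a
   time; each supremum is taken with all the other intervals kept fixed. *)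
Lemma list_ac_total_variation a b f d e L K :
  (forall M, all (in_segment a b) M -> pairwise apart M -> total_length M < d ->
     list_variation f M <= e) ->
  all (in_segment a b) (L ++ K) -> pairwise apart (L ++ K) ->
  total_length (L ++ K) < d ->
  (\sum_(p <- L) total_variation p.1 p.2 f + (list_variation f K)%:E <= e%:E)%E.
Proof.
move=> acf; elim: L K => [|[x y] L ih] K.
  by move=> *; rewrite big_nil add0e lee_fin; exact: acf.
move=> /= /andP[xyab abLK] /andP[xyLK apLK] lLK.
have xab := xyab; move: xab => /and3P[/= ax xy yb].
rewrite big_cons/= -addeA.
(* Dropping [(x, y)] shortens the list, so the induction hypothesis bounds the remaining terms by
   [e]. Being finite, they can cross the inequality, which leaves a bare supremum over the
   partitions of [[x, y]]. *)
have fin : (\sum_(p <- L) total_variation p.1 p.2 f + (list_variation f K)%:E)%E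
    \is a fin_num.
  have le1 := ih K abLK apLK _.
  rewrite ge0_fin_numE.
    apply: (@le_lt_trans _ _ e%:E); last exact: ltry.
    apply: le1; apply: le_lt_trans lLK.
    by rewrite /total_length big_cons/= lerDr subr_ge0.
  rewrite adde_ge0//; last by rewrite lee_fin sumr_ge0.
  rewrite big_seq sume_ge0// => p pL; apply: total_variation_ge0.
  by have /(allP abLK)/and3P[] : p \in L ++ K by rewrite mem_cat pL.
rewrite -leeBrDr//.
apply: ge_ereal_sup => _ [_ [s xys <-] <-].
rewrite leeBrDr// variation_cells// addeCA -EFinD.
have xys' := xys; move: xys' => -[xs /eqP lxs].
have -> : list_variation f (cells x s) + list_variation f K =
  list_variation f (cells x s ++ K) by rewrite /list_variation big_cat.
have /andP[cs ca] := path_cells xs.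
have cab : all (in_segment a b) (cells x s).
  apply: sub_all cs; rewrite lxs => p /and3P[h1 h2 h3]; apply/and3P; split => //.
    exact: le_trans h1.
  exact: le_trans yb.
have cLK : allrel apart (cells x s) (L ++ K).
  apply/allrelP => p q pc qLK; apply: (@apart_cell x y).
    by move/allP: cs => /(_ _ pc); rewrite lxs.
  by move/allP : xyLK; exact.
apply: ih.
- by move: abLK; rewrite !all_cat cab => /andP[-> ->].
- have cL : allrel apart L (cells x s).
    rewrite allrelC (eq_allrel (r' := apart)); last by move=> p q; exact: apartC.
    by move: cLK; rewrite allrel_catr => /andP[].
  move: apLK cLK; rewrite !pairwise_cat !allrel_catr => /and3P[-> -> ->].
  by move=> /andP[_ ->]; rewrite cL ca.
- move: lLK; rewrite /total_length big_cons big_cat/= !big_cat/=.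
  rewrite -/(total_length (cells x s)) (total_length_cells lxs).
  by rewrite addrCA.
Qed.

End ac_lists.

(** * The variation function of an absolutely continuous function *)

Section ac_variation_function.
Context {R : realType} (a b : R) (f : R -> R).
Hypotheses (ab : a <= b) (acf : list_ac a b f).

(** A piece shorter than the [d] attached to [e = 1] has variation at most 1. Pieces of length
    [d / 2] satisfy the strict bound, and finitely many of them cover [[a, b]]. *)
Lemma list_ac_bounded_variation : total_variation a b f \is a fin_num.
Proof.
have [d d0 acd] := acf ltr01.
have step x y : a <= x -> x <= y -> y <= b -> y - x < d ->
    (total_variation x y f <= 1)%E.
  move=> ax xy yb yxd.
  have := @list_ac_total_variation R a b f d 1 [:: (x, y)] [::] acd.
  rewrite /total_length /list_variation !big_seq1 big_nil/= adde0 /in_segment/=.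
  by rewrite ax xy yb; exact.
have main n x : a <= x -> x <= b -> x <= a + n%:R * (d / 2) ->
    (total_variation a x f <= n%:R%:E)%E.
  elim: n x => [|n ih] x ax xb xn.
    have -> : x = a by apply/eqP; rewrite eq_le ax andbT (le_trans xn)// mul0r addr0.
    by rewrite total_variationxx.
  pose y := Num.min x (a + n%:R * (d / 2)).
  have yx : y <= x by rewrite ge_min lexx.
  have ay : a <= y by rewrite le_min ax lerDl mulr_ge0// divr_ge0// ltW.
  rewrite (total_variationD f ay yx) -natr1 EFinD; apply: leeD.
    by apply: ih => //; [exact: le_trans xb|rewrite ge_min lexx orbT].
  apply: step => //; rewrite /y /Num.min; case: ifPn => _; first by rewrite subrr.
  rewrite ltrBlDl (le_lt_trans xn)// -natr1 mulrDl mul1r addrA ltrD2l.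
  by rewrite ltr_pdivrMr// ltr_pMr// ltr1n.
have [n bn] : exists n : nat, b <= a + n%:R * (d / 2).
  exists (Num.bound ((b - a) / (d / 2))).
  rewrite -lerBlDl -ler_pdivrMr ?divr_gt0//.
  by apply/ltW/archi_boundP; rewrite divr_ge0 ?subr_ge0// ltW// divr_gt0.
rewrite ge0_fin_numE ?total_variation_ge0//.
exact: le_lt_trans (main n b ab (lexx _) bn) (ltry _).
Qed.

Definition variation_function x := fine (total_variation a x f).

Lemma variation_functionB x y : a <= x -> x <= y -> y <= b ->
  total_variation x y f = (variation_function y - variation_function x)%:E.
Proof.
move=> ax xy yb; have := list_ac_bounded_variation.
have xb := le_trans xy yb.
rewrite (total_variationD f (le_trans ax xy) yb) fin_numD => /andP[ayfin _].
have := ayfin; rewrite (total_variationD f ax xy) fin_numD => /andP[axfin xyfin].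
rewrite /variation_function (total_variationD f ax xy) fineD// addrAC subrr add0r.
by rewrite fineK.
Qed.

Lemma variation_function_ge x y : a <= x -> x <= y -> y <= b ->
  `|f y - f x| <= variation_function y - variation_function x.
Proof.
by move=> ax xy yb; rewrite -lee_fin -variation_functionB//; exact: total_variation_ge.
Qed.

(** The [d] that serves [f] also serves its variation: subdividing the intervals of a list keeps its
    total length, so the bound [e] holds for all subdivisions at once. *)
Lemma list_ac_variation_function : list_ac a b variation_function.
Proof.
move=> e /acf[d d0 acd]; exists d => // L abL apL Ld.
have := @list_ac_total_variation _ a b f d e L [::] acd.
rewrite cats0 /list_variation big_nil adde0 => /(_ abL apL Ld).
rewrite -lee_fin; apply: le_trans; rewrite -sumEFin big_seq [leRHS]big_seq.
apply: lee_sum => p /(allP abL)/and3P[ap pp pb].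
rewrite variation_functionB// lee_fin ger0_norm//.
by rewrite (le_trans _ (variation_function_ge ap pp pb)).
Qed.

End ac_variation_function.

(** The term in [A] inherits the modulus of [f] and the term in [B] is a Lipschitz part. The lemma
    serves for the sum of [f] and its variation, for C^1 functions, and for [f] times a sine. *)
Lemma list_ac_dominated (R : realType) (a b A B : R) (f h : R -> R) :
  0 <= A -> 0 <= B ->
  (forall x y, a <= x -> x <= y -> y <= b ->
    `|h y - h x| <= A * `|f y - f x| + B * (y - x)) ->
  list_ac a b f -> list_ac a b h.
Proof.
move=> A0 B0 hf acf e e0.
(* Dividing by [A + 1] and [B + 1] covers the cases where [A] or [B] is 0. *)
have A1 : 0 < A + 1 by rewrite ltr_wpDl.
have B1 : 0 < B + 1 by rewrite ltr_wpDl.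
have [d d0 acd] := acf (e / 2 / (A + 1)) ltac:(by rewrite !divr_gt0).
exists (Num.min d (e / 2 / (B + 1))); first by rewrite lt_min d0 !divr_gt0.
move=> L abL apL; rewrite lt_min => /andP[Ld LB].
have := acd _ abL apL Ld; rewrite ler_pdivlMr// => LA.
move: LB; rewrite ltr_pdivlMr// => LB.
apply: (@le_trans _ _ (A * list_variation f L + B * total_length L)).
  rewrite /list_variation /total_length !mulr_sumr -big_split/=.
  rewrite big_seq [leRHS]big_seq; apply: ler_sum => p.
  by move=> /(allP abL)/and3P[ap pp pb]; exact: hf.
have l0 : 0 <= total_length L.
  rewrite /total_length big_seq sumr_ge0// => p /(allP abL)/and3P[ap pp pb].
  by rewrite subr_ge0.
have v0 : 0 <= list_variation f L by exact: sumr_ge0.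
nra.
Qed.

(** * Exhaustion of open sets by dyadic cells *)

Section dyadic_grid.
Context {R : realType}.
Implicit Types (a b x : R) (U : set R) (L : seq (R * R)).

Definition half_open_union L : set R :=
  \big[setU/set0]_(p <- L) `]p.1, p.2]%classic.

Lemma half_open_unionP L x :
  half_open_union L x <-> exists2 p, p \in L & x \in `]p.1, p.2].
Proof.
rewrite /half_open_union; elim: L => [|p L ih].
  by rewrite big_nil; split => // -[].
rewrite big_cons; split.
  move=> [xp|/ih[q qL xq]]; first by exists p; rewrite ?mem_head.
  by exists q => //; rewrite in_cons qL orbT.
move=> [q]; rewrite in_cons => /predU1P[->|qL] xq; first by left.
by right; apply/ih; exists q.
Qed.

Lemma measurable_half_open_union L : measurable (half_open_union L).
Proof. exact: bigsetU_measurable. Qed.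

(** Stated for any measure with prescribed values on half-open intervals, so that it applies to the
    Stieltjes measure of [G] and, with [idfun], to Lebesgue measure. *)
Lemma measure_half_open_union (nu : {measure set (measurableTypeR R) -> \bar R})
    (G : R -> R) a b L :
  (forall x y, a <= x -> x <= y -> y <= b -> nu `]x, y]%classic = (G y - G x)%:E) ->
  all (in_segment a b) L -> pairwise apart L ->
  nu (half_open_union L) = (total_increment G L)%:E.
Proof.
move=> nuG; rewrite /total_increment.
elim: L => [_ _|[x y] L ih /= /andP[xyab abL] /andP[xyL apL]].
  by rewrite /half_open_union !big_nil measure0.
have /and3P[/= ax xy yb] := xyab.
rewrite /half_open_union !big_cons measureU//.
- by rewrite EFinD -ih//= nuG.
- exact: measurable_half_open_union.
- apply/seteqP; split => // z [/=]; rewrite in_itv/= => /andP[xz zy].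
  move=> /half_open_unionP[q qL]; rewrite in_itv/= => /andP[qz zq].
  have : apart (x, y) q by exact: (allP xyL).
  move=> /orP[/= h|/= h].
    by have := lt_le_trans (le_lt_trans h qz) zy; rewrite ltxx.
  by have := lt_le_trans (le_lt_trans h xz) zq; rewrite ltxx.
Qed.

Variables (a b : R).
Hypothesis ab : a < b.

Definition grid n k : R := a + (b - a) * (k%:R / 2 ^+ n).
Definition grid_cell n k := (grid n k, grid n k.+1).
(** A finite list filling [U] from inside: absolute continuity applies to each generation, and
    continuity from below of the measure passes to the limit. *)
Definition inner_cells U n :=
  [seq grid_cell n k | k <- [seq k <- iota 0 (2 ^ n)
    | asbool (`]grid n k, grid n k.+1]%classic `<=` U)]].

Lemma le_grid n k k' : (k <= k')%N -> grid n k <= grid n k'.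
Proof.
by move=> kk'; rewrite lerD2l ler_pM2l ?subr_gt0// ler_pM2r ?ler_nat// invr_gt0 exprn_gt0.
Qed.

Lemma grid_double n k : grid n.+1 k.*2 = grid n k.
Proof.
by rewrite /grid exprS -muln2 natrM [k%:R * _]mulrC invfM; congr (_ + _ * _);
  field; rewrite expf_neq0// pnatr_eq0.
Qed.

Lemma grid0 n : grid n 0 = a. Proof. by rewrite /grid mul0r mulr0 addr0. Qed.

Lemma grid_last n : grid n (2 ^ n) = b.
Proof. by rewrite /grid natrX divff ?expf_neq0 ?pnatr_eq0// mulr1 subrKC. Qed.

Lemma inner_cells_segment U n : all (in_segment a b) (inner_cells U n).
Proof.
apply/allP => p /mapP[k]; rewrite mem_filter mem_iota add0n => /andP[_ /= kn] ->.
rewrite /in_segment/= -{1}(grid0 n) -(grid_last n).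
by rewrite !le_grid.
Qed.

Lemma inner_cells_apart U n : pairwise apart (inner_cells U n).
Proof.
rewrite /inner_cells pairwise_map pairwise_filter//.
have := iota_ltn_sorted 0 (2 ^ n); rewrite sorted_pairwise; last exact: ltn_trans.
by apply: sub_pairwise => i j ij; rewrite /apart/= le_grid.
Qed.

Lemma inner_cells_sub U n : half_open_union (inner_cells U n) `<=` U.
Proof.
move=> x /half_open_unionP[p /mapP[k]]; rewrite mem_filter => /andP[/asboolP kU _] ->.
exact: kU.
Qed.

Lemma inner_cellsP U n x : half_open_union (inner_cells U n) x <->
  exists k, [/\ (k < 2 ^ n)%N, `]grid n k, grid n k.+1]%classic `<=` U &
    x \in `]grid n k, grid n k.+1]].
Proof.
rewrite half_open_unionP; split => [[p /mapP[k]]|[k [kn kU xk]]].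
  rewrite mem_filter mem_iota add0n => /andP[/asboolP kU /= kn] -> xk.
  by exists k.
exists (grid_cell n k) => //; apply/mapP; exists k => //.
rewrite mem_filter mem_iota add0n /= kn andbT.
exact/asboolP.
Qed.

Lemma inner_cells_nondecreasing U :
  nondecreasing_seq (fun n => half_open_union (inner_cells U n)).
Proof.
apply/nondecreasing_seqP => n; apply/subsetPset => x.
move=> /inner_cellsP[k [kn kU xk]]; apply/inner_cellsP.
have kn2 : (k.*2.+1 < 2 ^ n.+1)%N.
  by rewrite -doubleS in kn *; rewrite expnS mul2n ltn_Sdouble.
move: (xk); rewrite in_itv/= -grid_double -(grid_double n k.+1) => /andP[kx xk1].
have [xm|mx] := leP x (grid n.+1 k.*2.+1).
  exists k.*2; split; [exact: ltn_trans kn2| |by rewrite in_itv/= kx xm].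
  apply: subset_trans kU; apply: subset_itv; rewrite bnd_simp.
    by rewrite grid_double.
  by rewrite -(grid_double n k.+1) le_grid// doubleS.
exists k.*2.+1; split => //; last by rewrite in_itv/= mx xk1.
apply: subset_trans kU; apply: subset_itv; rewrite bnd_simp.
  by rewrite -(grid_double n k) le_grid.
by rewrite -(grid_double n k.+1).
Qed.

(** As soon as the cells are shorter than the radius of a ball around [x] inside [U], the cell
    containing [x] lies in [U]. *)
Lemma inner_cells_cover U : open U ->
  U `&` `]a, b] `<=` \bigcup_n half_open_union (inner_cells U n).
Proof.
move=> oU x [Ux /=]; rewrite in_itv/= => /andP[ax xb].
have [r /= r0 rU] : nbhs_ball x U by apply/nbhs_ballP; exact: open_nbhs_nbhs.
have [n nr] : exists n, (b - a) / 2 ^+ n < r.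
  exists (Num.bound ((b - a) / r)); rewrite ltr_pdivrMr ?exprn_gt0// mulrC.
  rewrite -ltr_pdivrMr// (lt_le_trans (archi_boundP _))//.
    by rewrite divr_ge0 ?subr_ge0// ltW.
  by rewrite -natrX ler_nat ltnW// ltn_expl.
exists n => //; apply/inner_cellsP.
have ex : exists k, x <= grid n k.+1.
  by exists (2 ^ n).-1; rewrite prednK ?expn_gt0// grid_last.
case: (ex_minnP ex) => k xk kmin.
have kx : grid n k < x.
  case: k kmin {xk} => [|k] kmin; first by rewrite grid0.
  by rewrite ltNge; apply/negP => /kmin; rewrite ltnn.
have kn : (k < 2 ^ n)%N.
  rewrite ltnNge; apply/negP => nk.
  by have := lt_le_trans kx xb; rewrite -(grid_last n) ltNge le_grid.
exists k; split => //; last by rewrite in_itv/= kx xk.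
move=> y /=; rewrite in_itv/= => /andP[ky yk]; apply: rU; rewrite /ball/=.
apply: le_lt_trans nr.
have -> : (b - a) / 2 ^+ n = grid n k.+1 - grid n k.
  by rewrite /grid -natr1; ring.
by rewrite ler_norml; apply/andP; split; lra.
Qed.

End dyadic_grid.

(** * Densities of absolutely continuous functions *)

Section monotone_ac_density.
Context {R : realType} (a b : R) (G : R -> R).
Hypotheses (ab : a < b) (ndG : {in `[a, b] &, {homo G : x y / x <= y}}).
Hypothesis acG : list_ac a b G.
Notation mu := (@lebesgue_measure R).

(** Composing with [clamp] extends [G] by constants outside [[a, b]], since a Stieltjes measure is
    built from a nondecreasing right-continuous function on the whole line. *)
Let clamp (x : R) := Num.max a (Num.min x b).

Let clamp_itv x : clamp x \in `[a, b].
Proof. by rewrite in_itv/= le_max lexx/= ge_max (ltW ab) ge_min lexx orbT. Qed.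

Let clamp_id x : a <= x -> x <= b -> clamp x = x.
Proof. by move=> ax xb; rewrite /clamp (min_idPl xb) (max_idPr ax). Qed.

Let clamp_homo x y : x <= y -> clamp x <= clamp y.
Proof.
move=> xy; rewrite /clamp ge_max !le_max lexx/=; apply/orP; right.
by rewrite le_min !ge_min xy lexx orbT.
Qed.

Let clampB x y : x <= y -> clamp y - clamp x <= y - x.
Proof.
move=> xy; rewrite /clamp /Num.min /Num.max.
by case: (ltP x b) => ?; case: (ltP y b) => ?; do 2 case: ltP => ?; lra.
Qed.

Let H x := G (clamp x).

Let H_nd : nondecreasing H.
Proof. by move=> x y xy; apply: ndG => //; exact: clamp_homo. Qed.

Let H_rc : right_continuous H.
Proof.
move=> x; apply/cvgrPdist_le => e e0.
have [d d0 acd] := acG e0; near=> y.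
have xy : x <= y by [].
have := acd [:: (clamp x, clamp y)].
rewrite /list_variation /total_length !big_seq1/= /in_segment/= clamp_homo//.
have := clamp_itv x; have := clamp_itv y; rewrite !in_itv/= => /andP[_ ->] /andP[-> _].
rewrite distrC; apply => //; rewrite (le_lt_trans (clampB xy))// ltrBlDr addrC.
near: y; apply: nbhs_right_lt; rewrite ltrDl//.
Unshelve. all: by end_near. Qed.

Let K : cumulative R R := HB.pack H (isCumulative.Build R _ R H H_nd H_rc).

Let nu : {measure set (measurableTypeR R) -> \bar R} := lebesgue_stieltjes_measure K.

Let nu_itv x y : a <= x -> x <= y -> y <= b -> nu `]x, y]%classic = (G y - G x)%:E.
Proof.
move=> ax xy yb; rewrite /nu/= /lebesgue_stieltjes_measure.
rewrite /measure_extension measurable_mu_extE/=; last exact: is_ocitv.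
by rewrite wlength_itv_bnd//= /H !clamp_id// ?(le_trans ax)// (le_trans xy).
Qed.

Let mu_itv x y : a <= x -> x <= y -> y <= b ->
  mu `]x, y]%classic = (idfun y - idfun x)%:E.
Proof.
move=> ax xy yb; rewrite lebesgue_measure_itv/= lte_fin.
by case: ltP => // yx; have -> : x = y; [apply: le_anti; rewrite xy|rewrite subrr].
Qed.

(** The inner dyadic cells of [U] have total length at most [mu U < d], so [G] increases by at most
    [e] over them; the bound passes to the increasing union, which contains [U] within []a, b]]. *)
Let nu_open (e d : R) (U : set R) :
  (forall L, all (in_segment a b) L -> pairwise apart L ->
     total_length L < d -> list_variation G L <= e) ->
  open U -> (mu U < d%:E)%E -> (nu (U `&` `]a, b]) <= e%:E)%E.
Proof.
move=> acd oU Ud; pose F n := half_open_union (inner_cells a b U n).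
have mF n : measurable (F n) by exact: measurable_half_open_union.
have mUF : measurable (\bigcup_n F n) by exact: bigcupT_measurable.
apply: (@le_trans _ _ (nu (\bigcup_n F n))).
  apply: le_measure; rewrite ?inE//; last exact: inner_cells_cover.
  by apply: measurableI => //; exact: open_measurable.
have cF := @nondecreasing_cvg_mu _ _ _ nu _ mF mUF (inner_cells_nondecreasing ab U).
rewrite -(cvg_lim _ cF)//; apply: lime_le; first by apply/cvg_ex; eexists; exact: cF.
apply: nearW => n.
have sn := inner_cells_segment ab U n; have an := inner_cells_apart ab U n.
rewrite /= /F (measure_half_open_union nu_itv)// lee_fin.
apply: le_trans (acd _ sn an _).
  by rewrite /total_increment /list_variation ler_sum// => p _; exact: ler_norm.
rewrite -lte_fin; apply: le_lt_trans Ud.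
have <- := measure_half_open_union mu_itv sn an.
apply: le_measure; rewrite ?inE.
- exact: measurable_half_open_union.
- exact: open_measurable.
- exact: inner_cells_sub.
Qed.

Let nu_fin : (nu `]a, b]%classic < +oo)%E.
Proof. by rewrite nu_itv// ?ltW// ltry. Qed.

Let mab : measurable (`]a, b]%classic : set (measurableTypeR R)).
Proof. exact: measurable_itv. Qed.

Let nu_ab : {finite_measure set (measurableTypeR R) -> \bar R} := mfrestr mab nu_fin.

(** A Lebesgue-null set lies in open sets of arbitrarily small Lebesgue measure, and these have
    small measure under [nu] by [nu_open]. *)
Let nu_dominated : nu_ab `<< mu.
Proof.
apply/null_content_dominatesP => A mA A0.
apply/eqP; rewrite eq_le measure_ge0 andbT; apply/lee_addgt0Pr => e e0.
rewrite add0e; have [d d0 acd] := acG e0.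
have [U [oU AU UAd]] := @lebesgue_regularity_outer R A d mA ltac:(by rewrite A0) d0.
apply: (@le_trans _ _ (nu (U `&` `]a, b]))).
  rewrite /nu_ab/= /mfrestr/= /mrestr/=; apply: le_measure; rewrite ?inE.
  - exact: measurableI.
  - by apply: measurableI => //; exact: open_measurable.
  - exact: setSI.
apply: nu_open acd _ _ => //.
rewrite -(setDUK AU) measureU//; last 2 first.
- by apply: measurableD => //; exact: open_measurable.
- by rewrite setDIK.
by rewrite A0 add0e.
Qed.

Lemma monotone_ac_density : exists g : R -> R,
  mu.-integrable setT (EFin \o g) /\
  forall x, a <= x -> x <= b -> (\int[mu]_(t in `]a, x]) (g t)%:E = (G x - G a)%:E)%E.
Proof.
have [g [g0 gfin ig gE]] := radon_nikodym_sigma_finite nu_dominated.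
exists (fine \o g); have -> : EFin \o (fine \o g) = g.
  by apply/funext => x /=; rewrite fineK.
split => // x ax xb; rewrite -nu_itv//.
under eq_integral do rewrite /= fineK//.
rewrite -gE//= /mfrestr/= /mrestr/=; congr (nu _).
by rewrite setIidl//; apply: subset_itvl; rewrite bnd_simp.
Qed.

End monotone_ac_density.

Section ac_density.
Context {R : realType}.
Notation mu := (@lebesgue_measure R).
Implicit Types (f g : R -> R) (a b x y : R).

(** Jordan decomposition: [f] is the difference of the nondecreasing functions [V + f] and [V], each
    of which has a density. *)
Lemma list_ac_density a b f : a < b -> list_ac a b f ->
  exists g : R -> R, mu.-integrable setT (EFin \o g) /\
  forall x, a <= x -> x <= b -> (\int[mu]_(t in `]a, x]) (g t)%:E = (f x - f a)%:E)%E.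
Proof.
move=> ab acf; have ab' := ltW ab.
pose V := variation_function a f.
have VB := @variation_function_ge R a b f ab' acf.
have itvP x : x \in `[a, b] -> a <= x /\ x <= b by rewrite in_itv/= => /andP[].
have [g1 [ig1 g1E]] : exists g : R -> R, mu.-integrable setT (EFin \o g) /\
    forall x, a <= x -> x <= b -> (\int[mu]_(t in `]a, x]) (g t)%:E = (V x - V a)%:E)%E.
  apply: (@monotone_ac_density _ a b) => //; last exact: list_ac_variation_function.
  move=> x y /itvP[ax _] /itvP[_ yb] xy; rewrite -subr_ge0.
  exact: le_trans (VB _ _ ax xy yb).
have [g2 [ig2 g2E]] : exists g : R -> R, mu.-integrable setT (EFin \o g) /\
    forall x, a <= x -> x <= b ->
    (\int[mu]_(t in `]a, x]) (g t)%:E = (V x + f x - (V a + f a))%:E)%E.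
  apply: (@monotone_ac_density _ a b (fun x => V x + f x)) => //.
    move=> x y /itvP[ax _] /itvP[_ yb] xy /=.
    by have := VB _ _ ax xy yb; rewrite ler_norml -/V => /andP[]; lra.
  (* An increment of [f] is at most that of [V] in absolute value, so an increment of [V + f] is at
     most twice that of [V]. *)
  apply: (@list_ac_dominated _ _ _ 2 0 V) => //; last exact: list_ac_variation_function.
  move=> x y ax xy yb; rewrite mul0r addr0.
  have h := VB _ _ ax xy yb; rewrite -/V in h.
  rewrite [`|V y - V x|]ger0_norm; last exact: le_trans h.
  by move: h; rewrite !ler_norml => /andP[? ?]; apply/andP; split; lra.
exists (g2 \- g1); split.
  by have := integrableB measurableT ig2 ig1; congr (_.-integrable _ _).
move=> x ax xb.
have S : `]a, x]%classic `<=` [set: R] by [].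
transitivity (\int[mu]_(t in `]a, x]) ((EFin \o g2) \- (EFin \o g1)) t)%E; first by [].
rewrite integralB//; [|exact: integrableS ig2|exact: integrableS ig1].
by rewrite g1E// g2E// -EFinB; congr (_%:E); ring.
Qed.

Lemma list_ac_derivable_ae a b f g : a < b -> mu.-integrable setT (EFin \o g) ->
  (forall x, a <= x -> x <= b -> (\int[mu]_(t in `]a, x]) (g t)%:E = (f x - f a)%:E)%E) ->
  {ae mu, forall x, `]a, b[%classic x -> derivable f x 1 /\ derive1 f x = g x}.
Proof.
move=> ab ig gE.
have lg : locally_integrable setT g by apply: open_integrable_locally => //; exact: openT.
have igS y : mu.-integrable [set` Interval (BRight a) (BRight y)] (EFin \o g).
  by apply: integrableS ig.
have := FTC1 igS lg.
apply: filterS; first exact: (ae_filter_ringOfSetsType mu).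
move=> x H; rewrite /= in_itv/= => /andP[ax xb].
have [] := H ltac:(by rewrite /= lte_fin).
set F := fun x => _; move=> dF F'.
(* Since [x] is interior to []a, b[], the indefinite integral agrees with [f - f a] on a whole
   neighbourhood, and differentiability transfers. *)
have Ff : {near x, F =1 (fun t => f t - f a)}.
  have : \forall t \near x, t \in `]a, b[ by apply: near_in_itvoo; rewrite in_itv/= ax xb.
  apply: filterS => t; rewrite in_itv/= => /andP[at_ tb].
  by rewrite /F /Rintegral gE ?ltW.
have E t : f t = f a + (f t - f a) by rewrite subrKC.
have D : is_derive x 1 (fun t => f t - f a) (g x).
  apply: (near_eq_is_derive Ff).
  by apply: DeriveDef; [exact: dF|rewrite -derive1E; exact: F'].
have D2 : is_derive x 1 f (g x).
  have -> : f = cst (f a) + (fun t => f t - f a) by apply/funext => t; rewrite fctE -E.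
  by rewrite -[g x]add0r; apply: is_deriveD.
by split; [exact: ex_derive|rewrite derive1E derive_val].
Qed.

End ac_density.

(** * A Borel representative of the derivative *)

Section right_difference_limit.
Context {R : realType}.
Notation mu := (@lebesgue_measure R).
Implicit Types (f : R -> R) (a b x y : R).

(* Unlike [derive1 f], this representative of the derivative is visibly Borel. *)
Definition rderiv f x : R :=
  fine (limn_esup (fun n => (n.+1%:R * (f (x + n.+1%:R^-1) - f x))%:E)).

Lemma rderivE f x : derivable f x 1 -> rderiv f x = derive1 f x.
Proof.
move=> /derivable1_diffP/derivable1_diffP df.
have /cvg_ex[/= l fl] := df.
have -> : derive1 f x = l.
  by rewrite derive1E; apply: cvg_lim.
rewrite /rderiv.
have cv : (n.+1%:R * (f (x + n.+1%:R^-1) - f x))%:E @[n --> \oo] --> l%:E.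
  apply: cvg_EFin; first exact: nearW.
  have /cvgr_dnbhsP/(_ (fun n => n.+1%:R^-1)) := fl.
  move=> h; have {}h := h (conj _ (@cvg_harmonic R)).
  have : (n.+1%:R * (f (x + n.+1%:R^-1) - f x)) @[n --> \oo] --> l.
    apply: cvg_trans (h _); last by move=> n; rewrite invr_eq0 pnatr_eq0.
    apply: near_eq_cvg; apply: nearW => n /=.
    by rewrite invrK [_%:A]mulr1 [_ + x]addrC.
  by [].
rewrite is_cvg_limn_esupE; last by apply/cvg_ex; exists l%:E.
by rewrite (cvg_lim _ cv).
Qed.

Lemma measurable_rderiv f : {in `]0, +oo[%classic, continuous f} ->
  measurable_fun (`]0, +oo[%classic : set R) (rderiv f).
Proof.
move=> cf; apply: (measurableT_comp (fine_measurable measurableT)).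
apply: measurable_fun_limn_esup => n; apply/measurable_EFinP.
apply: open_continuous_measurable_fun; first exact: interval_open.
move=> x; rewrite inE/= in_itv/= andbT => x0.
apply: cvgM; first exact: cvg_cst.
apply: cvgB; last by apply: cf; rewrite inE/= in_itv/= x0.
apply: continuous_comp; first by apply: cvgD; [exact: cvg_id|exact: cvg_cst].
by apply: cf; rewrite inE/= in_itv/= andbT addr_gt0.
Qed.

Definition list_ac_pos f := forall a b, 0 < a -> a < b -> list_ac a b f.

Variable f : R -> R.
Hypothesis acf : list_ac_pos f.

Lemma list_ac_pos_continuous : {in `]0, +oo[%classic, continuous f}.
Proof.
move=> x; rewrite inE/= in_itv/= andbT => x0; apply/cvgrPdist_le => e e0.
have x20 : 0 < x / 2 by rewrite divr_gt0.
have x21 : x / 2 < x + 1 by lra.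
have [d d0 acd] := acf x20 x21 e0.
have near_itv : \forall y \near x, y \in `](x / 2), (x + 1)[.
  by apply: near_in_itvoo; rewrite in_itv/=; apply/andP; split; lra.
near=> y.
have : y \in `](x / 2), (x + 1)[ by near: y; exact: near_itv.
rewrite in_itv/= => /andP[xy yx].
have : `|x - y| < d by near: y; exact: (nbhsx_ballx x d d0).
have [xley|ylex] := leP x y.
  rewrite ler0_norm ?subr_le0// opprB => yd.
  have := acd [:: (x, y)]; rewrite /list_variation /total_length !big_seq1/=.
  rewrite /in_segment/= distrC xley => -> //; rewrite !andbT; apply/andP; split; lra.
rewrite gtr0_norm ?subr_gt0// => yd.
have := acd [:: (y, x)]; rewrite /list_variation /total_length !big_seq1/=.
by rewrite /in_segment/= (ltW ylex) => -> //; rewrite !andbT; apply/andP; split; lra.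
Unshelve. all: by end_near. Qed.

Lemma list_ac_pos_derivable_ae :
  {ae mu, forall x, (`]0, +oo[%classic : set R) x -> derivable f x 1}.
Proof.
(* Countably many bounded intervals exhaust []0, +oo[]; the right end [n.+2] keeps the interval
   nonempty at [n = 0]. *)
have H n : {ae mu, forall x, `](n.+1%:R^-1), n.+2%:R[%classic x -> derivable f x 1}.
  have n0 : 0 < n.+1%:R^-1 :> R by rewrite invr_gt0.
  have n1 : n.+1%:R^-1 < n.+2%:R :> R.
    by rewrite (@le_lt_trans _ _ 1)// ?invf_le1// ?ler1n// ltr1n.
  have [g [ig gE]] := list_ac_density n1 (acf n0 n1).
  have := list_ac_derivable_ae n1 ig gE.
  apply: filterS; first exact: (ae_filter_ringOfSetsType mu).
  by move=> x h xn; have [] := h xn.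
have := ae_foralln H.
apply: filterS.
move=> x h /=; rewrite in_itv/= andbT => x0.
apply: (h (Num.bound x + Num.bound x^-1)%N); rewrite /= in_itv/=; apply/andP; split.
  have xV0 : 0 <= x^-1 by rewrite invr_ge0 ltW.
  rewrite invf_plt ?posrE// (lt_le_trans (archi_boundP xV0))//.
  by rewrite ler_nat (leq_trans (leq_addl _ _) (leqnSn _)).
rewrite (lt_le_trans (archi_boundP (ltW x0)))// ler_nat.
by rewrite (leq_trans (leq_addr _ _) (leq_trans (leqnSn _) (leqnSn _))).
Qed.

Lemma rderiv_ftc x y : 0 < x -> x <= y ->
  mu.-integrable `]x, y] (EFin \o rderiv f) /\
  (\int[mu]_(t in `]x, y]) (rderiv f t)%:E = (f y - f x)%:E)%E.
Proof.
move=> x0 xy; have xy1 : x < y + 1 by lra.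
(* Working up to [y + 1] puts []x, y]] inside the open interval where the derivative is identified,
   and covers the degenerate case [x = y]. *)
have [g [ig gE]] := list_ac_density xy1 (acf x0 xy1).
have aeg := list_ac_derivable_ae xy1 ig gE.
have mg : measurable_fun `]x, y] (EFin \o g).
  by apply: (measurable_funS measurableT) => //; exact: measurable_int ig.
have mr : measurable_fun `]x, y] (EFin \o rderiv f).
  apply/measurable_EFinP; apply: measurable_funS (measurable_rderiv list_ac_pos_continuous) => //.
  by apply: subset_itv; rewrite bnd_simp ?ltW.
have eqr : ae_eq mu `]x, y]%classic (EFin \o g) (EFin \o rderiv f).
  move: aeg; apply: filterS; first exact: (ae_filter_ringOfSetsType mu).
  move=> t h /= txy; have [|df <-] := h _.
    by move: txy; rewrite /= !in_itv/= => /andP[-> ty]/=; rewrite (le_lt_trans ty)// ltrDl.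
  by rewrite rderivE.
split.
  apply/integrableP; split => //.
  have /integrableP[_] : mu.-integrable `]x, y] (EFin \o g) by exact: integrableS ig.
  rewrite (@ae_eq_integral _ _ _ mu _ (fun t => `|(rderiv f t)%:E|)%E)//.
  - exact: measurableT_comp.
  - exact: measurableT_comp.
  - by apply: filterS eqr => t h /h ->.
rewrite -(@ae_eq_integral _ _ _ mu _ (EFin \o rderiv f) (EFin \o g))//.
by rewrite gE// lerDl.
Qed.

(** The integral of a nonnegative function is a supremum over the simple functions below it, hence
    monotone for functions of any kind. *)
Lemma ge0_le_integral_patch (D E : set R) (g h : R -> \bar R) :
  (forall x, D x -> 0 <= g x)%E -> (forall x, E x -> 0 <= h x)%E ->
  (forall x, (g \_ D) x <= (h \_ E) x)%E ->
  (\int[mu]_(x in D) g x <= \int[mu]_(x in E) h x)%E.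
Proof.
move=> g0 h0 gh; rewrite !ge0_integralE//.
apply: ereal_sup_le => _ /= [k kg <-]; exists k => // x.
exact: le_trans (kg x) (gh x).
Qed.

(* [derive1 f] may fail to be Borel, and this comparison does not require it. *)
Lemma le_integral_rderiv_derive1 x : 0 < x ->
  (\int[mu]_(t in `]x, +oo[) `|(rderiv f t)%:E| <=
   \int[mu]_(t in `]x, +oo[) `|(derive1 f t)%:E|)%E.
Proof.
move=> x0; have [N [mN N0 NP]] := list_ac_pos_derivable_ae.
(* Measurability is known for the integrand on the left, so the exceptional null set is removed on
   that side; off it the two derivatives agree pointwise. *)
rewrite (@ge0_negligible_integral _ _ _ mu _ N)//; last first.
  apply: measurableT_comp => //; apply/measurable_EFinP.
  apply: measurable_funS (measurable_rderiv list_ac_pos_continuous) => //.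
  by apply: subset_itvr; rewrite bnd_simp ltW.
apply: ge0_le_integral_patch => // t; rewrite !patchE.
case: ifPn => [|_]; last by case: ifPn => // _; exact: abse_ge0.
rewrite inE => -[/= tx Nt]; rewrite mem_set// rderivE//.
apply: contrapT => nd; apply: Nt; apply: NP => /= h; apply: nd; apply: h.
by move: tx; rewrite !in_itv/= !andbT; exact: lt_trans.
Qed.

End right_difference_limit.

(** * Improper integrals *)

Section improper_integrals.
Context {R : realType}.
Notation mu := (@lebesgue_measure R).
Implicit Types (h H : R -> R) (a x y : R).

(** Dominated convergence with majorant [|h|]. The sets eventually contain each point but form no
    chain, as befits the cut-off points used at infinity, which come in no order. *)
Lemma cvg_Rintegral_exhaustion (D : set (measurableTypeR R)) (F : (set (measurableTypeR R))^nat) h :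
  measurable D -> (forall n, measurable (F n)) -> (forall n, F n `<=` D) ->
  (forall t, D t -> \forall n \near \oo, F n t) ->
  mu.-integrable D (EFin \o h) ->
  \int[mu]_(t in F n) h t @[n --> \oo] --> \int[mu]_(t in D) h t.
Proof.
move=> mD mF FD DF ih; have /integrableP[mh _] := ih.
pose f_ n : measurableTypeR R -> \bar R := (EFin \o h) \_ (F n).
have mf_ n : measurable_fun D (f_ n).
  by apply: measurable_funS (measurableT) _ _ => //;
     apply/(measurable_restrictT _ _).1 => //; exact: measurable_funS mh.
have f_f : {ae mu, forall t, D t -> f_ ^~ t @ \oo --> (EFin \o h) t}.
  apply/aeW => t Dt; apply: cvg_near_cst; apply: filterS (DF _ Dt) => n Fnt.
  by rewrite /f_ patchE mem_set.
have f_g : {ae mu, forall t n, D t -> (`|f_ n t| <= (abse \o (EFin \o h)) t)%E}.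
  apply/aeW => t n Dt; rewrite /f_ patchE; case: ifPn => // _.
  by rewrite abse0 abse_ge0.
have [_ _] := @dominated_convergence _ _ _ mu D mD f_ _ _ mf_ mh f_f (integrable_abse ih) f_g.
rewrite -(fineK (integrable_fin_num mD ih)) => /fine_cvg.
have -> : fine \o [sequence (\int[mu]_(t in D) f_ n t)%E]_n =
    (fun n => \int[mu]_(t in F n) h t).
  apply/funext => n /=; rewrite /Rintegral -integral_mkcondr.
  by rewrite setIidr.
exact.
Qed.

(** Monotone convergence along the intervals []a + 1/(n+1), a + n + 2]], which fill the half-line
    from both ends. *)
Lemma integrable_of_bounded_integrals h (M : R) a :
  measurable_fun (`]a, +oo[%classic : set R) h ->
  (forall t, a < t -> 0 <= h t) ->
  (forall x y, a < x -> x < y -> (\int[mu]_(t in `]x, y]) (h t)%:E <= M%:E)%E) ->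
  mu.-integrable `]a, +oo[ (EFin \o h).
Proof.
move=> mh h0 hM; pose F n : set (measurableTypeR R) := `]a + n.+1%:R^-1, a + n.+2%:R]%classic.
have aF n : a < a + n.+1%:R^-1 by rewrite ltrDl invr_gt0.
have FD n : F n `<=` `]a, +oo[%classic.
  by apply: subset_itv; rewrite bnd_simp// ltW.
have FE : `]a, +oo[%classic = \bigcup_n F n.
  apply/seteqP; split => [t|t [n _ /FD]//]; rewrite /= in_itv/= andbT => at_.
  have ta : 0 < t - a by rewrite subr_gt0.
  have taV : 0 <= (t - a)^-1 by rewrite invr_ge0 ltW.
  exists (Num.bound (t - a) + Num.bound (t - a)^-1)%N => //=.
  rewrite /F/= in_itv/= -ltrBrDl -lerBlDl; apply/andP; split.
    rewrite invf_plt ?posrE// (lt_le_trans (archi_boundP taV))//.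
    by rewrite ler_nat (leq_trans (leq_addl _ _) (leqnSn _)).
  rewrite (le_trans (ltW (archi_boundP (ltW ta))))// ler_nat.
  by rewrite (leq_trans (leq_addr _ _) (leq_trans (leqnSn _) (leqnSn _))).
have mF n : measurable_fun (F n) (EFin \o h).
  by apply/measurable_EFinP; apply: measurable_funS mh.
apply/integrableP; split; first exact/measurable_EFinP.
have -> : (\int[mu]_(t in `]a, +oo[) `|(EFin \o h) t| = \int[mu]_(t in `]a, +oo[) (EFin \o h) t)%E.
  by apply: eq_integral => t; rewrite inE/= in_itv/= andbT => at_; rewrite ger0_norm//; exact: h0.
apply: (@le_lt_trans _ _ M%:E); last exact: ltry.
have ndF : nondecreasing_seq F.
  apply/nondecreasing_seqP => n; apply/subsetPset; apply: subset_itv; rewrite bnd_simp lerD2l.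
    by rewrite lef_pV2 ?posrE// ler_nat.
  by rewrite ler_nat.
have F0 n t : F n t -> (0 <= (EFin \o h) t)%E.
  by move=> /FD; rewrite /= in_itv/= andbT lee_fin; exact: h0.
have := @ge0_nondecreasing_set_cvg_integral _ (measurableTypeR R) _ F (EFin \o h) mu ndF
  (fun n => measurable_itv _) mF F0.
rewrite -FE => cF; rewrite -(cvg_lim _ cF)//; apply: lime_le.
  by apply/cvg_ex; eexists; exact: cF.
apply: nearW => n; apply: hM => //.
rewrite ltrD2l (@le_lt_trans _ _ 1)// ?invf_le1// ?ler1n// ltr1n//.
Qed.

Lemma improper_ftc h H a (A B : R) : mu.-integrable `]a, +oo[ (EFin \o h) ->
  (forall x y, a < x -> x < y -> \int[mu]_(t in `]x, y]) h t = H y - H x) ->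
  H x @[x --> a^'+] --> A -> H x @[x --> +oo] --> B ->
  \int[mu]_(t in `]a, +oo[) h t = B - A.
Proof.
move=> ih hH HA HB; pose F n : set (measurableTypeR R) := `]a + n.+1%:R^-1, a + n.+2%:R]%classic.
have aF n : a < a + n.+1%:R^-1 by rewrite ltrDl invr_gt0.
have F_ : \int[mu]_(t in F n) h t @[n --> \oo] --> \int[mu]_(t in `]a, +oo[) h t.
  apply: cvg_Rintegral_exhaustion => //.
  - by move=> n; exact: measurable_itv.
  - by move=> n; apply: subset_itv; rewrite bnd_simp// ltW.
  move=> t; rewrite /= in_itv/= andbT => at_.
  have ta : 0 < t - a by rewrite subr_gt0.
  near=> n; rewrite /F/= in_itv/= -ltrBrDl -lerBlDl; apply/andP; split.
    by near: n; exact: near_infty_natSinv_lt (PosNum ta).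
  rewrite (@le_trans _ _ n%:R)//; last by rewrite ler_nat (leq_trans (leqnSn _)).
  by near: n; exact: nbhs_infty_ger.
apply: (@cvg_unique _ (@Rhausdorff R) _ _ _ _ F_).
have -> : (fun n => \int[mu]_(t in F n) h t) =
    (fun n => H (a + n.+2%:R) - H (a + n.+1%:R^-1)).
  apply/funext => n; rewrite hH//.
  by rewrite ltrD2l (@le_lt_trans _ _ 1)// ?invf_le1// ?ler1n// ltr1n.
apply: cvgB.
  move/cvg_pinftyP : HB; apply.
  apply/cvgryPge => M; near=> n; rewrite -lerBlDl.
  rewrite (@le_trans _ _ n%:R)//; last by rewrite ler_nat (leq_trans (leqnSn _)).
  by near: n; exact: nbhs_infty_ger.
move/cvg_at_rightP : HA; apply; split => //.
rewrite -[X in _ --> X]addr0; apply: cvgD; first exact: cvg_cst.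
exact: cvg_harmonic.
Unshelve. all: by end_near. Qed.

Lemma ftc_pos h H x y : 0 < x -> x < y ->
  {in `]0, +oo[%classic, continuous h} ->
  (forall t : R, 0 < t -> is_derive t 1 H (h t)) ->
  mu.-integrable `]x, y] (EFin \o h) /\
  (\int[mu]_(t in `]x, y]) (h t)%:E = (H y - H x)%:E)%E.
Proof.
move=> x0 xy ch dH.
have ch' : {within `[x, y], continuous h}.
  apply: continuous_in_subspaceT => t; rewrite inE/= in_itv/= => /andP[xt _].
  by apply: ch; rewrite inE/= in_itv/= andbT (lt_le_trans x0).
have cH t : 0 < t -> {for t, continuous H}.
  by move=> t0; apply/differentiable_continuous/derivable1_diffP; case: (dH _ t0).
have ih : mu.-integrable `[x, y] (EFin \o h).
  by apply: continuous_compact_integrable => //; exact: segment_compact.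
have ih' : mu.-integrable `]x, y] (EFin \o h).
  by apply: integrableS ih => //; exact: subset_itv_oc_cc.
split => //; rewrite (@integral_itv_obnd_cbnd R x (BRight y) (EFin \o h)); last first.
  exact: measurable_int ih'.
rewrite (continuous_FTC2 xy ch' (F := H)) ?EFinB//.
  split.
  - move=> t; rewrite in_itv/= => /andP[xt _]; by case: (dH _ (lt_trans x0 xt)).
  - by apply: cvg_at_right_filter; exact: cH.
  - by apply: cvg_at_left_filter; exact: cH (lt_trans x0 xy).
move=> t; rewrite in_itv/= => /andP[xt _]; rewrite derive1E.
by case: (dH _ (lt_trans x0 xt)).
Qed.

End improper_integrals.

(** * Closure properties of integrable real-valued functions *)

Section real_valued_integrable.
Context {R : realType}.
Notation mu := (@lebesgue_measure R).
Variable D : set (measurableTypeR R).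
Hypothesis mD : measurable D.
Implicit Types (h k : R -> R) (c : R).

Lemma integrable_fun_scale c h : mu.-integrable D (EFin \o h) ->
  mu.-integrable D (EFin \o (fun t => c * h t)).
Proof. by move=> ih; have := integrableZl mD c ih; apply: eq_integrable. Qed.

Lemma integrable_fun_add h k : mu.-integrable D (EFin \o h) ->
  mu.-integrable D (EFin \o k) -> mu.-integrable D (EFin \o (fun t => h t + k t)).
Proof. by move=> ih ik; have := integrableD mD ih ik; apply: eq_integrable. Qed.

Lemma integrable_fun_sub h k : mu.-integrable D (EFin \o h) ->
  mu.-integrable D (EFin \o k) -> mu.-integrable D (EFin \o (fun t => h t - k t)).
Proof. by move=> ih ik; have := integrableB mD ih ik; apply: eq_integrable. Qed.

Lemma integrable_fun_opp h : mu.-integrable D (EFin \o h) ->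
  mu.-integrable D (EFin \o (fun t => - h t)).
Proof. by move=> /(integrable_fun_scale (-1)); apply: eq_integrable => // t _ /=; rewrite mulN1r. Qed.

Lemma integrable_fun_norm h : mu.-integrable D (EFin \o h) ->
  mu.-integrable D (EFin \o (fun t => `|h t|)).
Proof. by move=> ih; have := integrable_abse ih; apply: eq_integrable. Qed.

Lemma integrable_fun_le h k : measurable_fun D h -> (forall t, D t -> `|h t| <= k t) ->
  mu.-integrable D (EFin \o k) -> mu.-integrable D (EFin \o h).
Proof.
move=> mh hk; apply: le_integrable => //; first exact/measurable_EFinP.
by move=> t Dt; rewrite /= lee_fin (le_trans (hk _ Dt))// ler_norm.
Qed.

Lemma measurable_fun_of_integrable h : mu.-integrable D (EFin \o h) -> measurable_fun D h.
Proof. by move=> /integrableP[/measurable_EFinP]. Qed.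

Lemma integrable_fun_mul_bounded h k : mu.-integrable D (EFin \o h) ->
  measurable_fun D k -> (forall t, D t -> `|k t| <= 1) ->
  mu.-integrable D (EFin \o (fun t => h t * k t)).
Proof.
move=> ih mk k1; apply: integrable_fun_le (integrable_fun_norm ih).
  by apply: measurable_funM => //; exact: measurable_fun_of_integrable.
by move=> t Dt; rewrite normrM ler_piMr// k1.
Qed.

End real_valued_integrable.

Section cosine_integrable.
Context {R : realType}.
Notation mu := (@lebesgue_measure R).
Variable D : set (measurableTypeR R).
Hypothesis mD : measurable D.
Implicit Types (h k : R -> R).

Lemma measurable_cos_affine (a b : R) : measurable_fun D (fun t => cos (a * t + b)).
Proof.
apply: measurable_funTS; apply: continuous_measurable_fun => t.
apply: (@continuous_comp _ _ _ (fun t => a * t + b) cos); last exact: continuous_cos.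
by apply: cvgD; [apply: cvgM; [exact: cvg_cst|exact: cvg_id]|exact: cvg_cst].
Qed.

Lemma integrable_mul_cos h (a b : R) : mu.-integrable D (EFin \o h) ->
  mu.-integrable D (EFin \o (fun t => h t * cos (a * t + b))).
Proof.
move=> ih; apply: integrable_fun_mul_bounded => //; first exact: measurable_cos_affine.
by move=> t _; exact: cos_max.
Qed.

End cosine_integrable.

(** * Derivatives and the function [s^a e^-s] *)

Section pointwise_derivatives.
Context {R : realType}.
Implicit Types (f g : R -> R) (x df dg : R).

Lemma is_derive1D f g x df dg : is_derive x 1 f df -> is_derive x 1 g dg ->
  is_derive x 1 (fun t => f t + g t) (df + dg).
Proof. by move=> hf hg; exact: (@is_deriveD _ _ _ f g). Qed.

Lemma is_derive1M f g x df dg : is_derive x 1 f df -> is_derive x 1 g dg ->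
  is_derive x 1 (fun t => f t * g t) (df * g x + f x * dg).
Proof.
move=> hf hg; apply: (is_derive_eq (f := (f * g : R -> R)) (is_deriveM hf hg)).
by rewrite /GRing.scale/= addrC [g x * _]mulrC.
Qed.

Lemma is_derive1Z f (k x df : R) : is_derive x 1 f df ->
  is_derive x 1 (fun t => k * f t) (k * df).
Proof. by move=> hf; exact: (@is_deriveZ _ _ _ f k). Qed.

Lemma is_derive1N f x df : is_derive x 1 f df ->
  is_derive x 1 (fun t => - f t) (- df).
Proof. by move=> hf; exact: (@is_deriveN _ _ _ f). Qed.

Lemma is_derive1_fun_comp f g x df dg :
  is_derive (g x) 1 f df -> is_derive x 1 g dg ->
  is_derive x 1 (fun t => f (g t)) (df * dg).
Proof. by move=> hf hg; exact: (@is_derive1_comp _ f g). Qed.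

Lemma is_derive1_affine (a b x : R) : is_derive x 1 (fun t => a * t + b) a.
Proof.
by apply: is_derive_eq; rewrite /GRing.scale/= mulr1 addr0.
Qed.

Lemma is_derive1_cos_affine (a b x : R) :
  is_derive x 1 (fun t => cos (a * t + b)) (- (a * sin (a * x + b))).
Proof.
apply: (is_derive_eq (is_derive1_fun_comp (is_derive_cos _) (is_derive1_affine a b x))).
by rewrite mulrC mulrN.
Qed.

Lemma is_derive1_sin_affine (a b x : R) :
  is_derive x 1 (fun t => sin (a * t + b)) (a * cos (a * x + b)).
Proof.
apply: (is_derive_eq (is_derive1_fun_comp (is_derive_sin _) (is_derive1_affine a b x))).
by rewrite mulrC.
Qed.

Lemma is_derive1_expRN x : is_derive x 1 (fun t => expR (- t)) (- expR (- x)).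
Proof.
apply: (is_derive_eq (is_derive1_fun_comp (is_derive_expR _) (is_derive1N (is_derive_id x 1)))).
by rewrite mulrN1.
Qed.

Lemma is_derive1_continuous f x df : is_derive x 1 f df -> {for x, continuous f}.
Proof. by move=> [hf _]; apply/differentiable_continuous/derivable1_diffP. Qed.

End pointwise_derivatives.

Section gamma_density.
Context {R : realType}.
Notation mu := (@lebesgue_measure R).
Implicit Types (a q s x y : R).

Definition gamma_density a s : R := s `^ a * expR (- s).

Lemma gamma_density_ge0 a s : 0 <= gamma_density a s.
Proof. by rewrite mulr_ge0// ?powR_ge0// expR_ge0. Qed.

Lemma gamma_densityS a s : 0 < s -> gamma_density (a + 1) s = s * gamma_density a s.
Proof.
move=> s0; rewrite /gamma_density powRD; last by rewrite (gt_eqF s0) implybT.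
by rewrite powRr1 ?(ltW s0)// mulrA [s * _]mulrC.
Qed.

Lemma is_derive_gamma_density a s : 0 < s ->
  is_derive s 1 (gamma_density a) (a * gamma_density (a - 1) s - gamma_density a s).
Proof.
move=> s0; rewrite /gamma_density.
apply: (is_derive_eq (is_derive1M (is_derive1_powR a s0) (is_derive1_expRN s))).
by rewrite mulrN mulrA.
Qed.

Lemma continuous_gamma_density a : {in `]0, +oo[%classic, continuous (gamma_density a)}.
Proof.
move=> s; rewrite inE/= in_itv/= andbT => s0.
exact: is_derive1_continuous (is_derive_gamma_density a s0).
Qed.

Lemma measurable_gamma_density a :
  measurable_fun (`]0, +oo[%classic : set R) (gamma_density a).
Proof.
apply: open_continuous_measurable_fun; first exact: interval_open.
exact: continuous_gamma_density.
Qed.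

Lemma powR_le_1D q s : 0 <= q -> q <= 1 -> 0 < s -> s `^ q <= 1 + s.
Proof.
move=> q0 q1 s0; have [s1|s1] := leP s 1.
  apply: (@le_trans _ _ 1); last by rewrite lerDl ltW.
  have : s `^ q <= 1 `^ q by apply: ge0_ler_powR; rewrite ?nnegrE// ltW.
  by rewrite powR1.
by rewrite (le_trans (ler1_powR (ltW s1) q1))// lerDr.
Qed.

Lemma mul1D_expRN_le1 s : 0 <= s -> (1 + s) * expR (- s) <= 1.
Proof.
by move=> s0; rewrite expRN ler_pdivrMr ?expR_gt0// mul1r expR_ge1Dx.
Qed.

(** One majorant of [s^q e^-s] for all [q] in [[0, 1]], with the elementary bounded antiderivative
    [E1]. *)
Let E s : R := (1 + s) * expR (- s).
Let E1 s : R := - ((2 + s) * expR (- s)).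

Let dlin c s : is_derive s 1 (fun t => c + t) (0 + 1).
Proof. by apply: is_derive1D. Qed.

Let dE1 s : is_derive s 1 E1 (E s).
Proof.
apply: (is_derive_eq (is_derive1N (is_derive1M (dlin 2 s) (is_derive1_expRN s)))).
by rewrite /E/=; ring.
Qed.

Let E1_bound s : 0 < s -> -2 <= E1 s <= 0.
Proof.
move=> s0; have e0 := expR_gt0 (- s).
rewrite /E1 lerN2 oppr_le0 mulr_ge0 ?andbT; [|lra|exact: ltW].
rewrite mulrDl; have := mul1D_expRN_le1 (ltW s0); rewrite mulrDl.
have : expR (- s) <= 1 by rewrite -expR0 ler_expR oppr_le0 ltW.
by lra.
Qed.

Let contE s : {for s, continuous E}.
Proof.
exact: is_derive1_continuous (is_derive1M (dlin 1 s) (is_derive1_expRN s)).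
Qed.

Lemma gamma_density_le q s : 0 <= q -> q <= 1 -> 0 < s ->
  gamma_density q s <= (1 + s) * expR (- s).
Proof. by move=> q0 q1 s0; rewrite ler_pM2r ?expR_gt0// powR_le_1D. Qed.

Let gamma_density_le1 q s : 0 <= q -> q <= 1 -> 0 < s -> gamma_density q s <= 1.
Proof.
move=> q0 q1 s0; apply: le_trans (gamma_density_le q0 q1 s0) _.
exact: mul1D_expRN_le1 (ltW s0).
Qed.

Lemma integrable_gamma_density01 q : 0 <= q -> q <= 1 ->
  mu.-integrable `]0, +oo[ (EFin \o gamma_density q).
Proof.
move=> q0 q1; have itv s : (`]0, +oo[%classic : set R) s -> 0 < s.
  by rewrite /= in_itv/= andbT.
apply: (@le_integrable _ _ _ mu `]0, +oo[ _ _ (EFin \o E)) => //.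
- by apply/measurable_EFinP; exact: measurable_gamma_density.
- move=> s /itv s0; rewrite /= lee_fin !ger0_norm ?gamma_density_ge0//.
    exact: gamma_density_le.
  by rewrite mulr_ge0// ?expR_ge0// addr_ge0// ltW.
(* [E1] takes its values in [[-2, 0]], so its increments are at most 2. *)
apply: (@integrable_of_bounded_integrals _ _ 2).
- by apply: open_continuous_measurable_fun => // s _; exact: contE.
- by move=> t t0; rewrite mulr_ge0 ?expR_ge0// addr_ge0// ltW.
move=> x y x0 xy; 
have cE : {in `]0, +oo[%classic, continuous E} by move=> s _; exact: contE.
have [_ ->] := ftc_pos x0 xy cE (fun t _ => dE1 t).
have /andP[_ y0] := E1_bound (lt_trans x0 xy); have /andP[x2 _] := E1_bound x0.
by rewrite lee_fin; lra.
Qed.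

(* [q s^(q-1) e^-s] is dominated by the derivative of the bounded function
   [s^q e^-s - (2 + s) e^-s]. *)
Lemma integrable_gamma_density q : 0 < q -> q <= 1 ->
  mu.-integrable `]0, +oo[ (EFin \o gamma_density (q - 1)).
Proof.
move=> q0 q1; have itv s : (`]0, +oo[%classic : set R) s -> 0 < s.
  by rewrite /= in_itv/= andbT.
pose K s := (q * gamma_density (q - 1) s - gamma_density q s) + E s.
pose K1 s := gamma_density q s + E1 s.
have dK s : 0 < s -> is_derive s 1 K1 (K s).
  by move=> s0; apply: is_derive1D; [exact: is_derive_gamma_density|exact: dE1].
have cK : {in `]0, +oo[%classic, continuous K}.
  move=> s; rewrite inE => /itv s0; apply: cvgD; last exact: contE.
  apply: cvgB; last by apply: continuous_gamma_density; rewrite inE/= in_itv/= s0.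
  apply: cvgM; first exact: cvg_cst.
  by apply: continuous_gamma_density; rewrite inE/= in_itv/= s0.
have K_ge s : 0 < s -> q * gamma_density (q - 1) s <= K s.
  by move=> s0; rewrite /K -addrA lerDl addrC subr_ge0 gamma_density_le// ltW.
have iK : mu.-integrable `]0, +oo[ (EFin \o K).
  (* [K1] adds to [E1], with values in [[-2, 0]], a function with values in [[0, 1]]; its increments
     are at most 3. *)
  apply: (@integrable_of_bounded_integrals _ _ 3).
  - by apply: open_continuous_measurable_fun => //; exact: interval_open.
  - by move=> t t0; rewrite (le_trans _ (K_ge _ t0))// mulr_ge0 ?gamma_density_ge0// ltW.
  move=> x y x0 xy; have [_ ->] := ftc_pos x0 xy cK dK.
  have y0 := lt_trans x0 xy.
  have /andP[_ y0'] := E1_bound y0; have /andP[x2 _] := E1_bound x0.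
  have := gamma_density_le1 (ltW q0) q1 y0; have := gamma_density_ge0 q x.
  by rewrite lee_fin /K1; lra.
apply: (@le_integrable _ _ _ mu `]0, +oo[ _ _ (EFin \o (fun s => q^-1 * K s))) => //.
- by apply/measurable_EFinP; exact: measurable_gamma_density.
- move=> s /itv s0; rewrite /= lee_fin ger0_norm ?gamma_density_ge0//.
  rewrite (le_trans _ (ler_norm _))// mulrC ler_pdivlMr// mulrC.
  exact: K_ge.
exact: integrable_fun_scale.
Qed.

Lemma gamma_density_cvg0 q : 0 < q -> gamma_density q s @[s --> 0^'+] --> (0 : R).
Proof.
move=> q0; rewrite -[X in _ --> X](mul0r (expR (- 0))); apply: cvgM.
  exact: powR_cvg0.
apply: cvg_at_right_filter; exact: (is_derive1_continuous (is_derive1_expRN 0)).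
Qed.

Lemma gamma_density_cvgy q : 0 <= q -> q <= 1 ->
  gamma_density q s @[s --> +oo] --> (0 : R).
Proof.
move=> q0 q1.
(* Of the two factors [e^(-s/2)] in [e^(-s)], one absorbs [1 + s], because
   [1 + s <= 4 (1 + s/2) <= 4 e^(s/2)]. *)
have H : 4 * expR (- (s / 2)) @[s --> +oo] --> (0 : R).
  rewrite -(mulr0 4); apply: cvgM; first exact: cvg_cst.
  apply: (cvg_comp (fun s => s / 2) (fun t => expR (- t))); last exact: cvgr_expR.
  apply/cvgryPge => M; apply: filterS (nbhs_pinfty_ge (num_real (M * 2))) => s.
  by rewrite ler_pdivlMr.
apply: (@squeeze_cvgr _ _ _ _ (cst 0) (fun s => 4 * expR (- (s / 2)))) => //; last exact: cvg_cst.
near=> s; have s0 : 0 < s by near: s; apply: nbhs_pinfty_gt; rewrite num_real.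
rewrite gamma_density_ge0/= (le_trans (gamma_density_le q0 q1 s0))//.
have -> : expR (- s) = expR (- (s / 2)) * expR (- (s / 2)).
  by rewrite -expRD -opprD -splitr.
rewrite mulrA ler_pM2r ?expR_gt0// expRN ler_pdivrMr ?expR_gt0//.
by have := expR_ge1Dx (s / 2); lra.
Unshelve. all: by end_near. Qed.

End gamma_density.

(** * The Riemann-Lebesgue lemma *)

Section riemann_lebesgue.
Context {R : realType}.
Notation mu := (@lebesgue_measure R).
Implicit Types (g h : R -> R) (b x phi : R).

(** Only [s] is confined to the segment. Compactness is used in its near-covering form, the radius
    [d] running along the filter at the right of 0. *)
Lemma segment_uniform_continuity g (a b e : R) : continuous g -> 0 < e ->
  exists2 d, 0 < d & forall s t, s \in `[a, b] -> `|s - t| < d -> `|g s - g t| <= e.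
Proof.
move=> cg e0; have cK : compact (`[a, b]%classic : set R) by exact: segment_compact.
have /compact_near_coveringP nc := cK.
have [|d /= d0 dP] := nc R (0 : R)^'+
    (fun d s => forall t, `|s - t| < d -> `|g s - g t| <= e) _.
  move=> s _; have e20 : 0 < e / 2 by rewrite divr_gt0.
  have /cvgrPdist_lt/(_ _ e20)/nbhs_ballP[r /= r0 rP] := cg s.
  have r20 : 0 < r / 2 by rewrite divr_gt0.
  near=> s' d => t s't.
  have ss' : `|s - s'| < r / 2 by near: s'; exact: (nbhsx_ballx s _ r20).
  have dr : d < r / 2 by near: d; exact: nbhs_right_lt.
  have gs' : `|g s - g s'| < e / 2.
    by apply: rP; rewrite /ball/= (lt_le_trans ss')//; lra.
  have gt_ : `|g s - g t| < e / 2.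
    apply: rP; rewrite /ball/= -(subrK s' s) -addrA (le_lt_trans (ler_normD _ _))//.
    by rewrite [ltRHS]splitr ltrD// (lt_trans s't).
  rewrite -(subrK (g s) (g s')) -addrA (le_trans (ler_normD _ _))//.
  by rewrite distrC [leRHS]splitr lerD// ltW.
have d20 : 0 < d / 2 by rewrite divr_gt0.
exists (d / 2) => // s t sab st; apply: (dP (d / 2)) => //=.
by rewrite sub0r normrN gtr0_norm// ltr_pdivrMr// ltr_pMr// ltr1n.
Unshelve. all: by end_near. Qed.

Lemma norm_integral_cos_itv (a b x phi : R) : a <= b -> 0 < x ->
  `|\int[mu]_(t in `]a, b]) cos (x * t + phi)| <= 2 / x.
Proof.
rewrite le_eqVlt => /predU1P[<-|ab] x0.
  by rewrite set_itvoc0 Rintegral_set0 normr0 divr_ge0// ltW.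
have dsin (t : R) : is_derive t 1 (fun t => x^-1 * sin (x * t + phi)) (cos (x * t + phi)).
  apply: (is_derive_eq (is_derive1Z x^-1 (is_derive1_sin_affine x phi t))).
  by rewrite mulKf// gt_eqF.
have cc : continuous (fun t => cos (x * t + phi)).
  by move=> t; exact: is_derive1_continuous (is_derive1_cos_affine x phi t).
have mc D : measurable_fun (D : set R) (fun t => cos (x * t + phi)).
  by apply: measurable_funTS; exact: continuous_measurable_fun.
rewrite Rintegral_itv_obnd_cbnd; last first.
  apply: (@integrableS _ _ _ mu `[a, b]) => //; first exact: subset_itv_oc_cc.
  apply: continuous_compact_integrable; first exact: segment_compact.
  exact: continuous_subspaceT.
rewrite /Rintegral (@continuous_FTC2 _ _ (fun t => x^-1 * sin (x * t + phi)) _ _ ab)/=.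
- rewrite -mulrBr normrM gtr0_norm ?invr_gt0// mulrC ler_pM2r ?invr_gt0//.
  by rewrite (le_trans (ler_normB _ _))// lerD// sin_max.
- exact: continuous_subspaceT.
- split.
  + by move=> t _; case: (dsin t).
  + by apply: cvg_at_right_filter; exact: is_derive1_continuous (dsin a).
  + by apply: cvg_at_left_filter; exact: is_derive1_continuous (dsin b).
- by move=> t _; rewrite derive1E; case: (dsin t).
Qed.


(* Freezing [g] on the cells of a fine uniform subdivision of [0, b]. *)
Lemma riemann_lebesgue_continuous g b phi : continuous g -> 0 < b ->
  \int[mu]_(t in `]0, b]) (g t * cos (x * t + phi)) @[x --> +oo] --> (0 : R).
Proof.
move=> cg b0; apply/cvgr0Pnorm_le => e e0.
have e1 : 0 < e / 2 / b by rewrite !divr_gt0.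
have [d d0 dP] := @segment_uniform_continuity g 0 b _ cg e1.
have [c _ cM] : exists2 c, c \in `[0, b] & forall t, t \in `[0, b] -> `|g t| <= `|g c|.
  apply: (EVT_max (ltW b0)); apply: continuous_subspaceT => t.
  by apply: continuous_comp; [exact: cg|exact: norm_continuous].
pose M := `|g c|.
have M0 : 0 <= M by exact: normr_ge0.
pose m := (Num.bound (b / d)).+1.
pose eta := b / m%:R.
have m0 : 0 < m%:R :> R by rewrite ltr0n.
have eta0 : 0 < eta by rewrite divr_gt0.
have etad : eta < d.
  rewrite ltr_pdivrMr// mulrC -ltr_pdivrMr//.
  by rewrite (lt_le_trans (archi_boundP _)) ?ler_nat// divr_ge0// ltW.
have ic (D : set (measurableTypeR R)) (k : R -> R) (x : R) :
    measurable D -> D `<=` `[0, b]%classic -> continuous k ->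
    mu.-integrable D (EFin \o (fun t => k t * cos (x * t + phi))).
  move=> mD D0b ck; apply: (@integrableS _ _ _ mu `[0, b]) => //.
  apply: continuous_compact_integrable; first exact: segment_compact.
  apply: continuous_subspaceT => t; apply: cvgM; first exact: ck.
  exact: is_derive1_continuous (is_derive1_cos_affine x phi t).
have step k (x : R) : 0 < x -> (k <= m)%N ->
    `|\int[mu]_(t in `]0, k%:R * eta]) (g t * cos (x * t + phi))| <=
    k%:R * (M * (2 / x) + (e / 2 / b) * eta).
  move=> x0; elim: k => [_|k ih km].
    by rewrite !mul0r set_itvoc0 Rintegral_set0 normr0.
  have kb : k.+1%:R * eta <= b.
    by rewrite /eta mulrCA ger_pMr// ler_pdivrMr// mul1r ler_nat.
  have k0 : 0 <= k%:R * eta by rewrite mulr_ge0// ltW.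
  have kk : k%:R * eta <= k.+1%:R * eta by rewrite ler_pM2r// ler_nat.
  pose I : set (measurableTypeR R) := `]k%:R * eta, k.+1%:R * eta]%classic.
  have mI : measurable I by exact: measurable_itv.
  have I0b : I `<=` `[0, b]%classic.
    by apply: subset_itv; rewrite bnd_simp.
  have split_ := @Rintegral_itvB R (fun t => g t * cos (x * t + phi)) (BRight 0)
    (BRight (k.+1%:R * eta)) (k%:R * eta).
  have {}split_ := split_ (ic _ _ _ (measurable_itv _) _ cg) _ _.
  rewrite -(subrK (\int[mu]_(t in `]0, k%:R * eta]) (g t * cos (x * t + phi)))
    (\int[mu]_(t in `]0, k.+1%:R * eta]) (g t * cos (x * t + phi)))).
  rewrite split_ ?bnd_simp//; last by apply: subset_itv; rewrite bnd_simp.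
  rewrite (le_trans (ler_normD _ _))// -[X in _ <= X * _]natr1 mulrDl mul1r addrC lerD//.
    by apply: ih; exact: ltnW.
  have iI k' ck' := ic I k' x mI I0b ck'.
  have cgk : continuous (fun t => g t - g (k%:R * eta)).
    by move=> t; apply: cvgB; [exact: cg|exact: cvg_cst].
  have ccst (r : R) : continuous (fun _ : R => r) by move=> t; exact: cvg_cst.
  have i1 := iI _ (ccst 1); have i2 := iI _ cgk.
  have -> : \int[mu]_(t in I) (g t * cos (x * t + phi)) =
     g (k%:R * eta) * \int[mu]_(t in I) (1 * cos (x * t + phi)) +
     \int[mu]_(t in I) ((g t - g (k%:R * eta)) * cos (x * t + phi)).
    rewrite -RintegralZl// -RintegralD//; last exact: integrable_fun_scale.
    by apply: eq_Rintegral => t _; ring.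
  rewrite (le_trans (ler_normD _ _))// lerD//.
    rewrite normrM ler_pM//.
      by apply: cM; rewrite in_itv/= k0 (le_trans kk).
    under eq_Rintegral do rewrite mul1r.
    exact: norm_integral_cos_itv.
  rewrite (le_trans (le_normr_Rintegral mI i2))//.
  apply: (@le_trans _ _ (\int[mu]_(t in I) (e / 2 / b))).
    apply: le_Rintegral => //.
    - by have := integrable_fun_norm mI i2.
    - apply: (@integrableS _ _ _ mu `[0, b]) => //.
      apply: continuous_compact_integrable; first exact: segment_compact.
      exact: continuous_subspaceT.
    - move=> t It; rewrite normrM (@le_trans _ _ `|g t - g (k%:R * eta)|)//.
        by rewrite ler_piMr// cos_max.
      apply: dP; first exact: I0b.
      move: It; rewrite /I/= in_itv/= => /andP[kt tk].
      rewrite gtr0_norm ?subr_gt0// (le_lt_trans _ etad)// lerBlDl (le_trans tk)//.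
      by rewrite -natr1 mulrDl mul1r addrC.
  rewrite Rintegral_cst// /I/= lebesgue_measure_itv/= lte_fin.
  rewrite ltr_pM2r// ltr_nat ltnSn -EFinB/= -[k.+1%:R]natr1 mulrDl mul1r.
  by rewrite [X in X - _]addrC addrK.
have mb : m%:R * eta = b by rewrite mulrC divfK// gt_eqF.
near=> x.
have x0 : 0 < x by near: x; apply: nbhs_pinfty_gt; rewrite num_real.
have := step m x x0 (leqnn _); rewrite mb => /le_trans; apply.
have -> : m%:R * (M * (2 / x) + e / 2 / b * eta) = m%:R * M * 2 / x + e / 2.
  by rewrite mulrDr [X in _ + X]mulrCA mb divfK ?gt_eqF//; ring.
rewrite [leRHS]splitr lerD2r ler_pdivrMr// -ler_pdivrMl ?divr_gt0//.
Unshelve. all: by end_near. Qed.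

End riemann_lebesgue.

Section riemann_lebesgue_lemma.
Context {R : realType}.
Notation mu := (@lebesgue_measure R).
Implicit Types (g h : R -> R) (a b x phi : R).

Lemma norm_Rintegral_mul_cos (D : set (measurableTypeR R)) h x phi :
  measurable D -> mu.-integrable D (EFin \o h) ->
  `|\int[mu]_(t in D) (h t * cos (x * t + phi))| <= \int[mu]_(t in D) `|h t|.
Proof.
move=> mD ih; have ihc := integrable_mul_cos mD x phi ih.
apply: le_trans (le_normr_Rintegral mD ihc) _; apply: le_Rintegral => //.
- by have := integrable_fun_norm mD ihc.
- by have := integrable_fun_norm mD ih.
- by move=> t _; rewrite normrM ler_piMr// cos_max.
Qed.

Lemma Rintegral_tail_cvg0 h : mu.-integrable `]0, +oo[ (EFin \o h) ->
  forall e, 0 < e -> exists2 b, 0 < b & \int[mu]_(t in `]b, +oo[) `|h t| <= e.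
Proof.
move=> ih e e0; pose D : set (measurableTypeR R) := `]0, +oo[%classic.
have mD : measurable D by exact: measurable_itv.
have inh : mu.-integrable D (EFin \o (fun t => `|h t|)) by exact: integrable_fun_norm.
pose F n : set (measurableTypeR R) := `]0, n%:R]%classic.
have cF : \int[mu]_(t in F n) `|h t| @[n --> \oo] --> \int[mu]_(t in D) `|h t|.
  apply: cvg_Rintegral_exhaustion => //.
  - by move=> n; exact: measurable_itv.
  - by move=> n; apply: subset_itv; rewrite bnd_simp.
  move=> t; rewrite /D/= in_itv/= andbT => t0.
  near=> n; rewrite /F/= in_itv/= t0/=.
  by near: n; exact: nbhs_infty_ger.
move/cvgrPdist_le : cF => /(_ _ e0)[N _ NF].
exists N.+1%:R => //.
have := NF N.+1 (leqnSn _); apply: le_trans.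
rewrite /F (@Rintegral_itvB R _ (BRight 0) (BInfty _ false)) ?bnd_simp//.
exact: ler_norm.
Unshelve. all: by end_near. Qed.

(** Density argument: the tail beyond [b] and the distance in [L^1(]0, b])] from [h] to a continuous
    [g] are at most [e / 3] each, uniformly in [x], which leaves the continuous case. *)
Lemma riemann_lebesgue h phi : mu.-integrable `]0, +oo[ (EFin \o h) ->
  \int[mu]_(t in `]0, +oo[) (h t * cos (x * t + phi)) @[x --> +oo] --> (0 : R).
Proof.
move=> ih; apply/cvgr0Pnorm_le => e e0.
have e3 : 0 < e / 3 by rewrite divr_gt0.
have [b b0 hb] := Rintegral_tail_cvg0 ih e3.
pose D : set (measurableTypeR R) := `]0, +oo[%classic.
pose I : set (measurableTypeR R) := `]0, b]%classic.
pose J : set (measurableTypeR R) := `]b, +oo[%classic.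
have mD : measurable D by exact: measurable_itv.
have mI : measurable I by exact: measurable_itv.
have mJ : measurable J by exact: measurable_itv.
have ID : I `<=` D by apply: subset_itv; rewrite bnd_simp.
have JD : J `<=` D by apply: subset_itv; rewrite bnd_simp// ltW.
have ihI : mu.-integrable I (EFin \o h) by apply: integrableS ih.
have ihJ : mu.-integrable J (EFin \o h) by apply: integrableS ih.
have muI : (mu I < +oo)%E by rewrite /I/= lebesgue_measure_itv/= lte_fin b0 -EFinB ltry.
have [g_ [cg_ ig_ hg_]] := @approximation_continuous_integrable R I h mI muI ihI.
have [g cg [ig hg]] : exists2 g : R -> R, continuous g &
    mu.-integrable I (EFin \o g) /\ \int[mu]_(t in I) `|h t - g t| <= e / 3.
  have : fine \o (fun n => \int[mu]_(z in I) `|(h z - g_ n z)%:E|)%E @ \oo --> (0 : R).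
    exact: fine_cvg.
  move/cvgrPdist_le => /(_ _ e3)[n _ /(_ n (leqnn _))] H.
  exists (g_ n) => //; split; first exact: ig_.
  by move: H; rewrite sub0r normrN; apply: le_trans; exact: ler_norm.
have near_g := riemann_lebesgue_continuous phi cg b0.
move/cvgr0Pnorm_le : near_g => /(_ _ e3); apply: filterS => x gx.
have ihc := integrable_mul_cos mD x phi ih.
have -> : \int[mu]_(t in D) (h t * cos (x * t + phi)) =
    \int[mu]_(t in I) (g t * cos (x * t + phi)) +
    \int[mu]_(t in I) ((h t - g t) * cos (x * t + phi)) +
    \int[mu]_(t in J) (h t * cos (x * t + phi)).
  rewrite -RintegralD//; last 2 first.
  - exact: integrable_mul_cos.
  - by apply: integrable_mul_cos => //; exact: integrable_fun_sub.
  rewrite /J -(@Rintegral_itvB R _ (BRight 0) (BInfty _ false) b ihc) ?bnd_simp ?(ltW b0)//.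
  by rewrite addrC -[LHS](subrK (\int[mu]_(t in I) (h t * cos (x * t + phi)))); congr (_ + _);
    apply: eq_Rintegral => t _; ring.
have -> : e = e / 3 + e / 3 + e / 3 by field.
rewrite (le_trans (ler_normD _ _))// lerD//; last first.
  exact: le_trans (norm_Rintegral_mul_cos x phi mJ ihJ) hb.
rewrite (le_trans (ler_normD _ _))// lerD//.
by apply: le_trans hg; apply: norm_Rintegral_mul_cos => //; exact: integrable_fun_sub.
Qed.

End riemann_lebesgue_lemma.

(** * The transform of [s^(q-1) e^-s] *)

Lemma cosDpihalf (R : realType) (x : R) : cos (x + pi / 2) = - sin x.
Proof. by rewrite cosD cos_pihalf sin_pihalf mulr0 mulr1 sub0r. Qed.

Section gamma_cosine_transform.
Context {R : realType} (q : R).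
Notation mu := (@lebesgue_measure R).
Hypotheses (q_gt0 : 0 < q) (q_le1 : q <= 1).
Implicit Types (a s x phi : R).

(** The phase is a parameter because differentiation in [x] raises [a] by one and adds [pi / 2] to
    [phi], so one statement covers cosine and sine. *)
Definition gamma_cos a x phi : R :=
  \int[mu]_(s in `]0, +oo[) (gamma_density a s * cos (x * s + phi)).

Let D : set (measurableTypeR R) := `]0, +oo[%classic.
Let mD : measurable D. Proof. exact: measurable_itv. Qed.
Let DP s : D s -> 0 < s. Proof. by rewrite /D/= in_itv/= andbT. Qed.

Let iw : mu.-integrable D (EFin \o gamma_density (q - 1)).
Proof. exact: integrable_gamma_density. Qed.
Let iv : mu.-integrable D (EFin \o gamma_density q).
Proof. by apply: integrable_gamma_density01 => //; exact: ltW. Qed.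

(** The left-hand side is the integral of the derivative of [s^q e^-s cos (x s + phi)], which
    vanishes at both ends of the half-line since [q > 0]. *)
Lemma gamma_cos_by_parts x phi :
  q * gamma_cos (q - 1) x phi - gamma_cos q x phi
    + x * gamma_cos q x (phi + pi / 2) = 0.
Proof.
pose H s := gamma_density q s * cos (x * s + phi).
pose h s := (q * (gamma_density (q - 1) s * cos (x * s + phi))
  - gamma_density q s * cos (x * s + phi))
  + x * (gamma_density q s * cos (x * s + (phi + pi / 2))).
have dH s : 0 < s -> is_derive s 1 H (h s).
  move=> s0; apply: (is_derive_eq (is_derive1M (is_derive_gamma_density q s0)
    (is_derive1_cos_affine x phi s))).
  by rewrite /h addrA cosDpihalf; ring.
have iwc := integrable_mul_cos mD x phi iw.
have ivc := integrable_mul_cos mD x phi iv.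
have ivs := integrable_mul_cos mD x (phi + pi / 2) iv.
have i1 := integrable_fun_scale mD q iwc.
have i2 := integrable_fun_sub mD i1 ivc.
have i3 := integrable_fun_scale mD x ivs.
have ih : mu.-integrable D (EFin \o h) by exact: (integrable_fun_add mD i2 i3).
have -> : q * gamma_cos (q - 1) x phi - gamma_cos q x phi
    + x * gamma_cos q x (phi + pi / 2) = \int[mu]_(s in D) h s.
  by rewrite RintegralD// RintegralB// !RintegralZl.
have cg a : {in D, continuous (gamma_density a)} := @continuous_gamma_density R a.
have cc b s : {for s, continuous (fun s => cos (x * s + b))}.
  exact: is_derive1_continuous (is_derive1_cos_affine x b s).
have ch : {in D, continuous h}.
  move=> s sD; apply: cvgD; [apply: cvgB|].
  - by apply: cvgM; [exact: cvg_cst|apply: cvgM; [exact: cg|exact: cc]].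
  - by apply: cvgM; [exact: cg|exact: cc].
  - by apply: cvgM; [exact: cvg_cst|apply: cvgM; [exact: cg|exact: cc]].
have norm_le s : `|H s| <= gamma_density q s.
  by rewrite normrM (ger0_norm (gamma_density_ge0 _ _)) ler_piMr ?gamma_density_ge0 ?cos_max.
rewrite (@improper_ftc _ h H 0 0 0)// ?subrr//.
- move=> u t u0 ut; have [_] := ftc_pos u0 ut ch dH.
  by rewrite /Rintegral => ->.
- apply: norm_cvg0; apply: (@squeeze_cvgr _ _ _ _ (cst 0) (gamma_density q)).
  + by apply: nearW => s; rewrite normr_ge0 norm_le.
  + exact: cvg_cst.
  + exact: gamma_density_cvg0.
- apply: norm_cvg0; apply: (@squeeze_cvgr _ _ _ _ (cst 0) (gamma_density q)).
  + by apply: nearW => s; rewrite normr_ge0 norm_le.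
  + exact: cvg_cst.
  + by apply: gamma_density_cvgy => //; exact: ltW.
Qed.

(** Differentiation under the integral sign: the derivative in [x] of the integrand is dominated by
    the integrable [s^q e^-s], uniformly in [x]. *)
Lemma is_derive_gamma_cos x phi :
  is_derive x 1 (fun x => gamma_cos (q - 1) x phi) (gamma_cos q x (phi + pi / 2)).
Proof.
pose f x s := gamma_density (q - 1) s * cos (x * s + phi).
have dcos (y s : R) : is_derive y 1 (f ^~ s) (gamma_density (q - 1) s * - (s * sin (y * s + phi))).
  rewrite /f; apply: is_derive1Z.
  have -> : (fun t => cos (t * s + phi)) = (fun t => cos (s * t + phi)).
    by apply/funext => t; rewrite mulrC.
  by rewrite [y * s]mulrC; exact: is_derive1_cos_affine.
have pE (y s : R) : partial1of2 f y s = gamma_density (q - 1) s * - (s * sin (y * s + phi)).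
  by rewrite partial1of2E; exact: (@derive_val _ _ _ _ _ _ _ (dcos y s)).
have xI : (`]x - 1, x + 1[%classic : set R) x by rewrite /= in_itv/=; apply/andP; split; lra.
have intf (y : R) : (`]x - 1, x + 1[%classic : set R) y -> mu.-integrable D (EFin \o f y).
  by move=> _; exact: integrable_mul_cos.
have df (y s : R) : (`]x - 1, x + 1[%classic : set R) y -> D s -> derivable (f ^~ s) y 1.
  by move=> _ _; case: (dcos y s).
have G0 (s : R) : 0 <= gamma_density q s by exact: gamma_density_ge0.
have ub (y s : R) : (`]x - 1, x + 1[%classic : set R) y -> D s ->
    `|partial1of2 f y s| <= gamma_density q s.
  move=> _ /DP s0; rewrite pE -{2}(subrK 1 q) gamma_densityS// mulrC normrM.
  rewrite (ger0_norm (gamma_density_ge0 _ _)) ler_pM2r; last first.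
    by rewrite /gamma_density mulr_gt0 ?powR_gt0// expR_gt0.
  by rewrite normrN normrM (gtr0_norm s0) ler_piMr ?sin_max// ltW.
have E : \int[mu]_(s in D) (partial1of2 f ^~ s) x = gamma_cos q x (phi + pi / 2).
  apply: eq_Rintegral => s; rewrite inE => /DP s0.
  rewrite pE addrA cosDpihalf -{2}(subrK 1 q) gamma_densityS//.
  by ring.
apply: DeriveDef.
  exact: (derivable_under_integral mD xI intf df G0 iv ub).
by rewrite -derive1E (differentiation_under_integral mD xI intf df G0 iv ub) E.
Qed.

End gamma_cosine_transform.

(** * Closed form and asymptotics of the transform of the model *)

Section gamma_cosine_asymptotics.
Context {R : realType} (q : R).
Notation mu := (@lebesgue_measure R).
Hypotheses (q_gt0 : 0 < q) (q_le1 : q <= 1).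
Implicit Types (x : R).

Let D : set (measurableTypeR R) := `]0, +oo[%classic.
Let mD : measurable D. Proof. exact: measurable_itv. Qed.

(** Here [A + i S] and [P + i N] are the transforms of [s^(q-1) e^-s] and [s^q e^-s] against
    [e^(-i x s)]. The facts below read [q (A + i S) = (1 + i x) (P + i N)] and
    [(A + i S)' = - i (P + i N)], so [A + i S] solves [Z' = - i q Z / (1 + i x)]. *)
Let A x := gamma_cos (q - 1) x 0.
Let S x := gamma_cos (q - 1) x (pi / 2).
Let P x := gamma_cos q x 0.
Let N x := gamma_cos q x (pi / 2).

Let gamma_cos_pi x : gamma_cos q x (pi / 2 + pi / 2) = - P x.
Proof.
have ip := integrable_mul_cos mD x 0 (integrable_gamma_density01 (ltW q_gt0) q_le1).
rewrite /P /gamma_cos -mulN1r -RintegralZl//.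
apply: eq_Rintegral => s _.
by rewrite addrA cosDpihalf -[sin _]opprK -cosDpihalf -addrA -splitr cosDpi addr0; ring.
Qed.

Let parts1 x : q * A x = P x - x * N x.
Proof.
have := gamma_cos_by_parts q_gt0 q_le1 x 0; rewrite add0r -/(A x) -/(P x) -/(N x).
lra.
Qed.

Let parts2 x : q * S x = N x + x * P x.
Proof.
have := gamma_cos_by_parts q_gt0 q_le1 x (pi / 2).
rewrite gamma_cos_pi -/(S x) -/(N x); lra.
Qed.

Let k x : R := 1 + x ^+ 2.
Let k_gt0 x : 0 < k x. Proof. by rewrite /k ltr_pwDl// sqr_ge0. Qed.

(** [parts1] and [parts2] form a linear system in [P] and [N] with determinant [1 + x^2]. *)
Let NE x : N x = q * (S x - x * A x) / k x.
Proof.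
have k0 := lt0r_neq0 (k_gt0 x); apply: (mulIf k0); rewrite divfK//.
by transitivity (q * S x - x * (q * A x)); [rewrite parts1 parts2 /k|]; ring.
Qed.

Let PE x : P x = q * (A x + x * S x) / k x.
Proof.
have k0 := lt0r_neq0 (k_gt0 x); apply: (mulIf k0); rewrite divfK//.
by transitivity (q * A x + x * (q * S x)); [rewrite parts1 parts2 /k|]; ring.
Qed.

(** Modulus and argument of [(1 + i x)^q], the integrating factor of the equation. *)
Let rho x := k x `^ (q / 2).
Let theta x := q * atan x.

Let dA x : is_derive x 1 A (N x).
Proof. by have := is_derive_gamma_cos q_gt0 q_le1 x 0; rewrite add0r. Qed.

Let dS x : is_derive x 1 S (- P x).
Proof. by have := is_derive_gamma_cos q_gt0 q_le1 x (pi / 2); rewrite gamma_cos_pi. Qed.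

Let dk x : is_derive x 1 k (2 * x).
Proof.
have -> : k = (fun t => 1 + t * t) by apply/funext => t; rewrite /k expr2.
have d1 : is_derive x 1 (fun t : R => t) 1 by exact: is_derive_id.
have d0 : is_derive x 1 (fun=> 1 : R) 0 by exact: is_derive_cst.
apply: (is_derive_eq (is_derive1D d0 (is_derive1M d1 d1))).
by ring.
Qed.

Let drho x : is_derive x 1 rho (q * x / k x * rho x).
Proof.
have k0 := lt0r_neq0 (k_gt0 x).
apply: (is_derive_eq (is_derive1_fun_comp (is_derive1_powR (q / 2) (k_gt0 x)) (dk x))).
rewrite /rho -(mulr_powRB1 (ltW (k_gt0 x)) (divr_gt0 q_gt0 (ltr0n R 2))).
by field.
Qed.

Let dtheta x : is_derive x 1 theta (q / k x).
Proof. by apply: is_derive1Z; exact: is_derive1_atan. Qed.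

Let dcos x : is_derive x 1 (fun x => cos (theta x)) (- sin (theta x) * (q / k x)).
Proof. exact: is_derive1_fun_comp (is_derive_cos _) (dtheta x). Qed.

Let dsin x : is_derive x 1 (fun x => sin (theta x)) (cos (theta x) * (q / k x)).
Proof. exact: is_derive1_fun_comp (is_derive_sin _) (dtheta x). Qed.

(** Real and imaginary parts of [(1 + i x)^q (A + i S)], which is constant. *)
Let U x := rho x * (A x * cos (theta x) + - (S x * sin (theta x))).
Let W x := rho x * (S x * cos (theta x) + A x * sin (theta x)).

Let dU x : is_derive x 1 U 0.
Proof.
have k0 := lt0r_neq0 (k_gt0 x).
apply: (is_derive_eq (is_derive1M (drho x) (is_derive1D (is_derive1M (dA x) (dcos x))
  (is_derive1N (is_derive1M (dS x) (dsin x)))))).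
by rewrite NE PE; field.
Qed.

Let dW x : is_derive x 1 W 0.
Proof.
have k0 := lt0r_neq0 (k_gt0 x).
apply: (is_derive_eq (is_derive1M (drho x) (is_derive1D (is_derive1M (dS x) (dcos x))
  (is_derive1M (dA x) (dsin x))))).
by rewrite NE PE; field.
Qed.

Let A0 : A 0 = Gamma q.
Proof.
by apply: eq_Rintegral => s _; rewrite mul0r addr0 cos0 mulr1.
Qed.

Let S0 : S 0 = 0.
Proof.
transitivity (\int[mu]_(s in D) (0 : R)); last by rewrite Rintegral_cst ?mul0r.
by apply: eq_Rintegral => s _; rewrite mul0r add0r cos_pihalf mulr0.
Qed.

Let rho0 : rho 0 = 1. Proof. by rewrite /rho /k expr0n addr0 powR1. Qed.
Let theta0 : theta 0 = 0. Proof. by rewrite /theta atan0 mulr0. Qed.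

Let UE x : rho x * (A x * cos (theta x) - S x * sin (theta x)) = Gamma q.
Proof.
rewrite -/(U x) (@is_derive_0_is_cst _ U x 0 dU) /U rho0 theta0 cos0 sin0 A0.
by rewrite mulr0 subr0 mul1r mulr1.
Qed.

Let WE x : rho x * (S x * cos (theta x) + A x * sin (theta x)) = 0.
Proof.
rewrite -/(W x) (@is_derive_0_is_cst _ W x 0 dW) /W rho0 theta0 cos0 sin0 S0.
by rewrite mul0r mulr0 addr0 mulr0.
Qed.

Let rho_neq0 x : rho x != 0.
Proof. by rewrite gt_eqF// powR_gt0. Qed.

Lemma gamma_cos_0 x :
  gamma_cos (q - 1) x 0 = Gamma q * (1 + x ^+ 2) `^ (- (q / 2)) * cos (q * atan x).
Proof.
rewrite powRN -/(A x) -/(k x) -/(rho x) -/(theta x).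
apply: (mulfI (rho_neq0 x)); rewrite [RHS]mulrA [X in _ = X * _]mulrCA divff// mulr1.
(* Rotating back by the angle [theta]: [cos] times [UE] plus [sin] times [WE] isolates [rho A]. *)
rewrite -(UE x); transitivity (rho x * A x * (cos (theta x) ^+ 2 + sin (theta x) ^+ 2)).
  by rewrite cos2Dsin2 mulr1.
by rewrite -[RHS]addr0 -(mulr0 (sin (theta x))) -(WE x); ring.
Qed.

Lemma gamma_cos_pihalf x : gamma_cos (q - 1) x (pi / 2) =
  - (Gamma q * (1 + x ^+ 2) `^ (- (q / 2)) * sin (q * atan x)).
Proof.
rewrite powRN -/(S x) -/(k x) -/(rho x) -/(theta x).
apply: (mulfI (rho_neq0 x)); rewrite mulrN [X in _ = - X]mulrA [X in _ = - (X * _)]mulrCA.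
rewrite divff// mulr1.
rewrite -(UE x); transitivity (rho x * S x * (cos (theta x) ^+ 2 + sin (theta x) ^+ 2)).
  by rewrite cos2Dsin2 mulr1.
by rewrite -[RHS]addr0 -(mulr0 (cos (theta x))) -(WE x); ring.
Qed.

Lemma powR_ratio_cvg1 :
  x `^ q * (1 + x ^+ 2) `^ (- (q / 2)) @[x --> +oo] --> (1 : R).
Proof.
(* [t x] equals [x^2 / (1 + x^2)], and for [x > 0] the product in question is its power [q / 2]. *)
pose t x : R := 1 - (1 + x ^+ 2)^-1.
have t1 : t x @[x --> +oo] --> (1 : R).
  rewrite -[X in _ --> X]subr0; apply: cvgB; first exact: cvg_cst.
  apply/gtr0_cvgV0; first by apply: nearW => x; exact: k_gt0.
  apply/cvgryPge => M; near=> x.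
  have x1 : 1 <= x by near: x; apply: nbhs_pinfty_ge; rewrite num_real.
  have xM : M <= x by near: x; apply: nbhs_pinfty_ge; rewrite num_real.
  by nra.
have powt : t x `^ (q / 2) @[x --> +oo] --> (1 : R).
  rewrite -[X in _ --> X](_ : 1 `^ (q / 2) = 1); last by rewrite powR1.
  apply: (cvg_comp t (fun y => y `^ (q / 2)) t1).
  exact: is_derive1_continuous (is_derive1_powR (q / 2) ltr01).
apply: cvg_trans powt; apply: near_eq_cvg; near=> x.
have x0 : 0 < x by near: x; apply: nbhs_pinfty_gt; rewrite num_real.
have tE : k x * t x = x ^+ 2.
  have k0 := lt0r_neq0 (k_gt0 x).
  by rewrite /t -/(k x) mulrBr mulr1 divff// /k addrAC subrr add0r.
have t0 : 0 <= t x by rewrite -(pmulr_rge0 _ (k_gt0 x)) tE sqr_ge0.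
have -> : x `^ q = k x `^ (q / 2) * t x `^ (q / 2).
  rewrite -powRM// ?(ltW (k_gt0 x))// tE.
  by rewrite -powR_mulrn ?(ltW x0)// -powRrM mulrC divfK.
by rewrite powRN mulrAC divff ?mul1r// rho_neq0.
Unshelve. all: by end_near. Qed.

End gamma_cosine_asymptotics.

(** * Integration by parts and the remainder *)

Section integration_by_parts_ac.
Context {R : realType}.
Notation mu := (@lebesgue_measure R).
Implicit Types (f h r : R -> R) (a b u v x phi : R).

Lemma segment_norm_bound h a b : a <= b -> {within `[a, b], continuous h} ->
  exists2 M, 0 <= M & forall t, t \in `[a, b] -> `|h t| <= M.
Proof.
move=> ab ch; have [c _ cM] : exists2 c, c \in `[a, b] &
    forall t, t \in `[a, b] -> (Num.norm \o h) t <= (Num.norm \o h) c.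
  apply: EVT_max => // t.
  exact: (@continuous_comp (subspace `[a, b]%classic) _ _ h Num.norm t (ch t) (@norm_continuous _ R _)).
by exists `|h c|.
Qed.

Lemma list_ac_pos_C1 f h : (forall t : R, 0 < t -> is_derive t 1 f (h t)) ->
  {in `]0, +oo[%classic, continuous h} -> list_ac_pos f.
Proof.
move=> df ch a b a0 ab.
have cw c d (k : R -> R) : 0 < c -> {in `]0, +oo[%classic, continuous k} ->
    {within `[c, d], continuous k}.
  move=> c0 ck; apply: continuous_in_subspaceT => t; rewrite inE/= in_itv/= => /andP[ct _].
  by apply: ck; rewrite inE/= in_itv/= andbT (lt_le_trans c0).
have [M M0 hM] := segment_norm_bound (ltW ab) (cw a b h a0 ch).
apply: (@list_ac_dominated _ _ _ 0 M idfun) => //; last first.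
  move=> e e0; exists e => // L abL _ /ltW; apply: le_trans.
  rewrite /list_variation /total_length big_seq [leRHS]big_seq ler_sum// => p.
  by move=> /(allP abL)/and3P[_ pp _]; rewrite ger0_norm// subr_ge0.
move=> x y ax xy yb; rewrite mul0r add0r.
have x0 := lt_le_trans a0 ax.
have cf : {in `]0, +oo[%classic, continuous f}.
  by move=> t; rewrite inE/= in_itv/= andbT => t0; exact: is_derive1_continuous (df t t0).
have [|c cxy ->] := @MVT_segment _ f h x y xy _ (cw _ _ _ x0 cf).
  by move=> t; rewrite in_itv/= => /andP[xt _]; apply: df; exact: lt_trans xt.
rewrite normrM [`|y - x|]ger0_norm ?subr_ge0// ler_wpM2r ?subr_ge0//.
apply: hM; move: cxy; rewrite !in_itv/= => /andP[xc cy].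
by rewrite (le_trans ax xc) (le_trans cy yb).
Qed.

Lemma list_ac_pos_mul_sin f x phi : 0 < x -> list_ac_pos f ->
  list_ac_pos (fun t => f t * sin (x * t + phi)).
Proof.
move=> x0 acf a b a0 ab.
have [M M0 fM] : exists2 M, 0 <= M & forall t, t \in `[a, b] -> `|f t| <= M.
  apply: segment_norm_bound; first exact: ltW.
  apply: continuous_in_subspaceT => t; rewrite inE/= in_itv/= => /andP[at_ _].
  apply: (list_ac_pos_continuous acf).
  by rewrite inE/= in_itv/= andbT (lt_le_trans a0).
(* In the product rule for increments, [f] is bounded by [M] on the segment and the sine is
   Lipschitz with constant [x]. *)
apply: (@list_ac_dominated _ _ _ 1 (M * x) f) => //; [by rewrite mulr_ge0// ltW| |exact: acf].
move=> s t as_ st tb.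
have -> : f t * sin (x * t + phi) - f s * sin (x * s + phi) =
    (f t - f s) * sin (x * t + phi) + f s * (sin (x * t + phi) - sin (x * s + phi)).
  by ring.
rewrite (le_trans (ler_normD _ _))// lerD//.
  by rewrite normrM mul1r ler_piMr// sin_max.
rewrite normrM -mulrA ler_pM//.
  by apply: fM; rewrite in_itv/= as_ (le_trans st).
have dsin (t' : R) : is_derive t' 1 (fun t => sin (x * t + phi)) (x * cos (x * t' + phi)).
  exact: is_derive1_sin_affine.
have cs : {within `[s, t], continuous (fun t => sin (x * t + phi))}.
  by apply: continuous_subspaceT => t'; exact: is_derive1_continuous (dsin t').
have [c _ ->] := @MVT_segment _ (fun t => sin (x * t + phi)) (fun t => x * cos (x * t + phi)) s t st
  (fun t _ => dsin t) cs.
rewrite !normrM (gtr0_norm x0) [`|t - s|]ger0_norm ?subr_ge0//.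
by rewrite ler_wpM2r ?subr_ge0// ler_piMr ?cos_max// ltW.
Qed.

Lemma cosBpihalf x : cos (x - pi / 2) = sin x.
Proof. by rewrite cosB cos_pihalf sin_pihalf mulr0 mulr1 add0r. Qed.

(** The fundamental theorem applied to the absolutely continuous product [f t * sin (x t + phi)].
    The remaining sine is written as a cosine of phase [phi - pi / 2], so that the estimates for
    cosine integrals apply to it as well. *)
Lemma ac_by_parts_cos f u v x phi : list_ac_pos f -> 0 < u -> u <= v -> 0 < x ->
  x * \int[mu]_(t in `]u, v]) (f t * cos (x * t + phi)) =
  f v * sin (x * v + phi) - f u * sin (x * u + phi)
  - \int[mu]_(t in `]u, v]) (rderiv f t * cos (x * t + (phi - pi / 2))).
Proof.
move=> acf u0 uv x0; pose D : set (measurableTypeR R) := `]u, v]%classic.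
have mD : measurable D by exact: measurable_itv.
have D0 : D `<=` `]0, +oo[%classic by apply: subset_itv; rewrite bnd_simp// ltW.
pose F t := f t * sin (x * t + phi).
have acF : list_ac_pos F by exact: list_ac_pos_mul_sin.
have [ig _] := rderiv_ftc acf u0 uv.
have [iG GE] := rderiv_ftc acF u0 uv.
have cf : {in `]0, +oo[%classic, continuous f} by exact: list_ac_pos_continuous.
have if_ : mu.-integrable D (EFin \o f).
  apply: (@integrableS _ _ _ mu `[u, v]) => //; first exact: subset_itv_oc_cc.
  apply: continuous_compact_integrable; first exact: segment_compact.
  apply: continuous_in_subspaceT => t; rewrite inE/= in_itv/= => /andP[ut _].
  by apply: cf; rewrite inE/= in_itv/= andbT (lt_le_trans u0).
have i1 := integrable_mul_cos mD x (phi - pi / 2) ig.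
have i2 := integrable_fun_scale mD x (integrable_mul_cos mD x phi if_).
have i12 := integrable_fun_add mD i1 i2.
suff : \int[mu]_(t in D) rderiv F t =
    \int[mu]_(t in D) (rderiv f t * cos (x * t + (phi - pi / 2)) + x * (f t * cos (x * t + phi))).
  rewrite RintegralD// RintegralZl//; last exact: integrable_mul_cos.
  have -> : \int[mu]_(t in D) rderiv F t = F v - F u by rewrite /Rintegral GE.
  by rewrite /F => ->; rewrite addrAC subrr add0r.
rewrite /Rintegral; congr fine.
apply: (@ae_eq_integral _ _ _ mu D _ _ mD).
- exact: measurable_int iG.
- exact: measurable_int i12.
have := list_ac_pos_derivable_ae acf.
apply: filterS; first exact: (ae_filter_ringOfSetsType mu).
move=> t h Dt; congr EFin.
have dft : is_derive t 1 f (rderiv f t).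
  by rewrite rderivE; [rewrite derive1E; apply: DeriveDef => //|]; exact: h (D0 _ Dt).
have [dF FE] := is_derive1M dft (is_derive1_sin_affine x phi t).
rewrite rderivE// derive1E FE addrA cosBpihalf; ring.
Qed.

(** If [|h|] stayed above [1/(n+1)] beyond [n], its integral would exceed [k/(n+1)] for every [k].
    The points found stand in for a limit of [h] at infinity. *)
Lemma integrable_small_far h : mu.-integrable `]0, +oo[ (EFin \o h) ->
  forall n : nat, exists2 v, n%:R <= v & `|h v| <= n.+1%:R^-1.
Proof.
move=> ih n; apply: contrapT => far.
have big v : n%:R <= v -> n.+1%:R^-1 <= `|h v|.
  by move=> nv; rewrite leNgt; apply/negP => hv; apply: far; exists v => //; exact: ltW.
pose D : set (measurableTypeR R) := `]0, +oo[%classic.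
have mD : measurable D by exact: measurable_itv.
have inh : mu.-integrable D (EFin \o (fun t => `|h t|)) by exact: integrable_fun_norm.
pose c := \int[mu]_(t in D) `|h t|.
have le_c (k : nat) : n.+1%:R^-1 * k%:R <= c.
  pose J : set (measurableTypeR R) := `]n%:R, n%:R + k%:R]%classic.
  have mJ : measurable J by exact: measurable_itv.
  have muJ : mu J = k%:R%:E.
    rewrite /J/= lebesgue_measure_itv/= lte_fin ltrDl -EFinB addrAC subrr add0r.
    by case: ltP => // k0; congr EFin; apply/eqP; rewrite eq_le k0 ler0n.
  have JD : J `<=` D by apply: subset_itv; rewrite bnd_simp.
  rewrite -lee_fin /c /Rintegral fineK; last exact: integrable_fin_num inh.
  apply: (@le_trans _ _ (\int[mu]_(t in J) (n.+1%:R^-1)%:E)%E).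
    by rewrite integral_cst//= muJ EFinM.
  apply: (@le_trans _ _ (\int[mu]_(t in J) (`|h t|)%:E)%E).
    apply: ge0_le_integral => //.
    - by apply: measurable_funS (measurable_int _ inh).
    - move=> t; rewrite /J/= in_itv/= => /andP[nt _]; rewrite lee_fin.
      by apply: big; exact: ltW.
  apply: ge0_subset_integral => //; first exact: measurable_int inh.
have c0 : 0 <= c by exact: Rintegral_ge0.
have := le_c (Num.bound (n.+1%:R * c)); rewrite leNgt => /negP; apply.
rewrite mulrC ltr_pdivlMr// mulrC; apply: archi_boundP.
by rewrite mulr_ge0.
Qed.

(** The upper end of integration runs through points [v n] tending to infinity with [f (v n)]
    tending to 0; both integrals converge because their integrands are integrable on the whole
    tail. *)
Lemma ac_tail_by_parts_cos f u x phi : list_ac_pos f ->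
  mu.-integrable `]0, +oo[ (EFin \o f) -> 0 < u -> 0 < x ->
  mu.-integrable `]u, +oo[ (EFin \o rderiv f) ->
  x * \int[mu]_(t in `]u, +oo[) (f t * cos (x * t + phi)) =
  - (f u * sin (x * u + phi))
  - \int[mu]_(t in `]u, +oo[) (rderiv f t * cos (x * t + (phi - pi / 2))).
Proof.
move=> acf if_ u0 x0 ig.
have /choice[v vP] : forall n : nat, exists v, n%:R <= v /\ `|f v| <= n.+1%:R^-1.
  by move=> n; have [v ? ?] := integrable_small_far if_ n; exists v.
pose D : set (measurableTypeR R) := `]u, +oo[%classic.
have mD : measurable D by exact: measurable_itv.
pose F n : set (measurableTypeR R) := `]u, v n]%classic.
have mF n : measurable (F n) by exact: measurable_itv.
have FD n : F n `<=` D by apply: subset_itv; rewrite bnd_simp.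
have DF t : D t -> \forall n \near \oo, F n t.
  rewrite /D/= in_itv/= andbT => ut; near=> n; rewrite /F/= in_itv/= ut/=.
  by apply: le_trans (vP n).1; near: n; exact: nbhs_infty_ger.
have if' : mu.-integrable D (EFin \o f).
  by apply: integrableS if_ => //; apply: subset_itv; rewrite bnd_simp// ltW.
have c1 := cvg_Rintegral_exhaustion mD mF FD DF (integrable_mul_cos mD x phi if').
have c2 := cvg_Rintegral_exhaustion mD mF FD DF (integrable_mul_cos mD x (phi - pi / 2) ig).
have fv0 : f (v n) * sin (x * v n + phi) @[n --> \oo] --> (0 : R).
  apply: norm_cvg0; apply: (@squeeze_cvgr _ _ _ _ (cst 0) (fun n => n.+1%:R^-1)).
  - apply: nearW => n; rewrite normr_ge0 normrM (le_trans _ (vP n).2)//.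
    by rewrite ler_piMr// sin_max.
  - exact: cvg_cst.
  - exact: cvg_harmonic.
have lhs : x * \int[mu]_(t in F n) (f t * cos (x * t + phi)) @[n --> \oo] -->
    x * \int[mu]_(t in D) (f t * cos (x * t + phi)).
  exact: cvgM (cvg_cst x) c1.
have rhs : f (v n) * sin (x * v n + phi) - f u * sin (x * u + phi)
      - \int[mu]_(t in F n) (rderiv f t * cos (x * t + (phi - pi / 2))) @[n --> \oo] -->
    0 - f u * sin (x * u + phi)
      - \int[mu]_(t in D) (rderiv f t * cos (x * t + (phi - pi / 2))).
  exact: cvgB (cvgB fv0 (cvg_cst _)) c2.
rewrite -[X in _ = X - _]sub0r.
apply: (@cvg_unique _ (@Rhausdorff R) _ _ _ _ lhs).
apply: cvg_trans rhs; apply: near_eq_cvg; near=> n.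
rewrite /F/=; apply/esym/ac_by_parts_cos => //.
apply: le_trans (vP n).1; near: n; exact: nbhs_infty_ger.
Unshelve. all: by end_near. Qed.

End integration_by_parts_ac.

(** * The remainder estimate *)

Section oscillating_remainder.
Context {R : realType}.
Notation mu := (@lebesgue_measure R).
Implicit Types (f g h r : R -> R) (p u x phi C d : R).

Lemma Rintegral_le_of_bounded h a (M : R) : mu.-integrable `]a, +oo[ (EFin \o h) ->
  (forall y, a < y -> \int[mu]_(t in `]a, y]) h t <= M) ->
  \int[mu]_(t in `]a, +oo[) h t <= M.
Proof.
move=> ih hM; pose D : set (measurableTypeR R) := `]a, +oo[%classic.
have mD : measurable D by exact: measurable_itv.
pose F n : set (measurableTypeR R) := `]a, a + n.+1%:R]%classic.
have cF : \int[mu]_(t in F n) h t @[n --> \oo] --> \int[mu]_(t in D) h t.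
  apply: cvg_Rintegral_exhaustion => //.
  - by move=> n; exact: measurable_itv.
  - by move=> n; apply: subset_itv; rewrite bnd_simp.
  move=> t; rewrite /D/= in_itv/= andbT => at_.
  near=> n; rewrite /F/= in_itv/= at_/= -lerBlDl (@le_trans _ _ n%:R)// ?ler_nat//.
  by near: n; exact: nbhs_infty_ger.
rewrite -/D -(cvg_lim (@Rhausdorff R) cF); apply: limr_le.
  by apply/cvg_ex; eexists; exact: cF.
by apply: nearW => n; apply: hM; rewrite ltrDl.
Unshelve. all: by end_near. Qed.

Lemma Rintegral_head_cvg0 h : mu.-integrable `]0, +oo[ (EFin \o h) ->
  forall e, 0 < e -> exists2 b, 0 < b & forall u, 0 < u -> u <= b ->
    \int[mu]_(t in `]0, u]) `|h t| <= e.
Proof.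
move=> ih e e0; pose D : set (measurableTypeR R) := `]0, +oo[%classic.
have mD : measurable D by exact: measurable_itv.
have inh : mu.-integrable D (EFin \o (fun t => `|h t|)) by exact: integrable_fun_norm.
pose F n : set (measurableTypeR R) := `]n.+1%:R^-1, +oo[%classic.
have cF : \int[mu]_(t in F n) `|h t| @[n --> \oo] --> \int[mu]_(t in D) `|h t|.
  apply: cvg_Rintegral_exhaustion => //.
  - by move=> n; exact: measurable_itv.
  - by move=> n; apply: subset_itv; rewrite bnd_simp.
  move=> t; rewrite /D/= in_itv/= andbT => t0.
  near=> n; rewrite /F/= in_itv/= andbT.
  by near: n; exact: near_infty_natSinv_lt (PosNum t0).
move/cvgrPdist_le : cF => /(_ _ e0)[N _ /(_ N (leqnn _)) NF].
have N0 : 0 < N.+1%:R^-1 :> R by rewrite invr_gt0.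
exists N.+1%:R^-1 => // u u0 uN.
apply: le_trans NF; apply: le_trans (ler_norm _).
rewrite lerBrDr /F -(@Rintegral_itvB R _ (BRight 0) (BInfty _ false) N.+1%:R^-1 inh) ?bnd_simp ?(ltW N0)//.
rewrite addrCA -[leRHS]addr0 lerD2l subr_le0.
have iN : mu.-integrable `]0, N.+1%:R^-1] (EFin \o (fun t => `|h t|)).
  by apply: integrableS inh => //; apply: subset_itv; rewrite bnd_simp.
rewrite -subr_ge0 (@Rintegral_itvB R _ (BRight 0) (BRight N.+1%:R^-1) u iN) ?bnd_simp ?(ltW u0)//.
exact: Rintegral_ge0.
Unshelve. all: by end_near. Qed.

Lemma integral_powR_head q u : 0 < q -> q <= 1 -> 0 < u ->
  mu.-integrable `]0, u] (EFin \o (fun s => s `^ (q - 1))) /\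
  \int[mu]_(s in `]0, u]) s `^ (q - 1) <= u `^ q / q.
Proof.
move=> q0 q1 u0; pose D : set (measurableTypeR R) := `]0, u]%classic.
have mD : measurable D by exact: measurable_itv.
have D0 : D `<=` `]0, +oo[%classic by apply: subset_itv; rewrite bnd_simp.
have DP s : D s -> 0 < s /\ s <= u by rewrite /D/= in_itv/= => /andP[].
have dpow (a s : R) : 0 < s -> is_derive s 1 (@powR R ^~ a) (a * s `^ (a - 1)).
  by move=> s0; exact: is_derive1_powR.
have ch : {in `]0, +oo[%classic, continuous (fun s : R => s `^ (q - 1))}.
  by move=> s; rewrite inE/= in_itv/= andbT => s0; exact: is_derive1_continuous (dpow _ _ s0).
have dH (s : R) : 0 < s -> is_derive s 1 (fun s => q^-1 * s `^ q) (s `^ (q - 1)).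
  move=> s0; apply: (is_derive_eq (is_derive1Z q^-1 (dpow q s s0))).
  by rewrite mulKf// gt_eqF.
have ih : mu.-integrable D (EFin \o (fun s => s `^ (q - 1))).
  have iw : mu.-integrable D (EFin \o gamma_density (q - 1)).
    by apply: integrableS (integrable_gamma_density q0 q1).
  (* On []0, u]] one has [1 <= e^(u - s)], so the power is dominated by [e^u] times the gamma
     density. *)
  apply: (@integrable_fun_le _ D mD _ (fun s => expR u * gamma_density (q - 1) s)).
  - apply: measurable_funS (open_continuous_measurable_fun (@interval_open _ _ _ _ _) ch) => //.
  - move=> s /DP[s0 su]; rewrite ger0_norm ?powR_ge0// /gamma_density mulrCA.
    by rewrite ler_peMr ?powR_ge0// -expRD -expR0 ler_expR subr_ge0.
  - exact: integrable_fun_scale.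
split => //.
(* Taking the minimum with [u] makes [F n] the empty interval []u, u]] as long as [1/(n+1)] exceeds
   [u]. *)
pose F n : set (measurableTypeR R) := `]Num.min u n.+1%:R^-1, u]%classic.
have cF : \int[mu]_(t in F n) t `^ (q - 1) @[n --> \oo] --> \int[mu]_(t in D) t `^ (q - 1).
  apply: cvg_Rintegral_exhaustion => //.
  - by move=> n; exact: measurable_itv.
  - by move=> n; apply: subset_itv; rewrite bnd_simp// le_min ltW//= invr_ge0.
  move=> t /DP[t0 tu]; near=> n; rewrite /F/= in_itv/= tu andbT gt_min; apply/orP; right.
  by near: n; exact: near_infty_natSinv_lt (PosNum t0).
rewrite -/D -(cvg_lim (@Rhausdorff R) cF); apply: limr_le.
  by apply/cvg_ex; eexists; exact: cF.
apply: nearW => n; rewrite /F.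
have m0 : 0 < Num.min u n.+1%:R^-1 by rewrite lt_min u0/= invr_gt0.
have : Num.min u n.+1%:R^-1 <= u by rewrite ge_min lexx.
rewrite le_eqVlt => /predU1P[->|mu_].
  by rewrite set_itvoc0 Rintegral_set0 divr_ge0 ?powR_ge0// ltW.
have [_ E] := ftc_pos m0 mu_ ch dH.
rewrite /Rintegral E/= [leRHS]mulrC lerBlDr lerDl mulr_ge0 ?powR_ge0// invr_ge0 ltW//.
Unshelve. all: by end_near. Qed.

(** [G] abstracts the integral against the derivative, which for [r = f - l m] is a combination of
    two such integrals. For [p > 0] the bound by [C] suffices; for [p = 0] the cut is made with
    [T = 1], whence the assumption on [G x^-1 x]. *)
Lemma oscillating_remainder_cvg0 p r (G : R -> R -> R) C d phi :
  0 <= p -> p < 1 ->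
  mu.-integrable `]0, +oo[ (EFin \o r) ->
  s `^ p * r s @[s --> 0^'+] --> (0 : R) ->
  (forall u x, 0 < u -> 0 < x ->
    x * \int[mu]_(t in `]u, +oo[) (r t * cos (x * t + phi)) =
    - (r u * sin (x * u + phi)) - G u x) ->
  0 < d -> (forall u x, 0 < u -> u < d -> u `^ p * `|G u x| <= C) ->
  (p = 0 -> G x^-1 x @[x --> +oo] --> (0 : R)) ->
  x `^ (1 - p) * \int[mu]_(t in `]0, +oo[) (r t * cos (x * t + phi))
    @[x --> +oo] --> (0 : R).
Proof.
move=> p0 p1 ir r0 tail d0 GC G0; apply/cvgr0Pnorm_le => e e0.
pose q := 1 - p; have q0 : 0 < q by rewrite subr_gt0.
have q1 : q <= 1 by rewrite /q gerBl.
have qp : q - 1 = - p by rewrite /q addrAC subrr add0r.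
have e3 : 0 < e / 3 by rewrite divr_gt0.
(* With [u = T / x], [x^(-p) |G u x|] is [u^p |G u x| / T^p], at most [C / T^p]; [T] is chosen so
   that [T^p >= |C| / (e / 3)]. The condition [1 <= T] gives [T^(-p) <= 1] for the boundary term. *)
have [T T1 near_G] : exists2 T, 1 <= T &
    \forall x \near +oo, x `^ (- p) * `|G (T / x) x| <= e / 3.
  move: p0; rewrite le_eqVlt => /predU1P[p0|p0].
    exists 1 => //; have /cvgr0Pnorm_le/(_ _ e3) := G0 (esym p0).
    by apply: filterS => x; rewrite -p0 oppr0 powRr0 !mul1r.
  exists (Num.max 1 ((`|C| / (e / 3)) `^ p^-1)); first by rewrite le_max lexx.
  set T := Num.max _ _.
  have T1 : 1 <= T by rewrite le_max lexx.
  have T0 : 0 < T by exact: lt_le_trans T1.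
  have CT : `|C| / (e / 3) <= T `^ p.
    have -> : `|C| / (e / 3) = ((`|C| / (e / 3)) `^ p^-1) `^ p.
      by rewrite -powRrM mulVf ?gt_eqF// powRr1// divr_ge0// ltW.
    apply: ge0_ler_powR; rewrite ?nnegrE ?powR_ge0 ?(ltW T0) ?(ltW p0)//.
    by rewrite le_max lexx orbT.
  near=> x.
  have x0 : 0 < x by near: x; apply: nbhs_pinfty_gt; rewrite num_real.
  have xd : T / x < d.
    rewrite ltr_pdivrMr// mulrC -ltr_pdivrMr//.
    by near: x; apply: nbhs_pinfty_gt; rewrite num_real.
  have Tp0 : 0 < T `^ p by exact: powR_gt0.
  have -> : x `^ (- p) = (T / x) `^ p / T `^ p.
    have -> : T `^ p = (T / x) `^ p * x `^ p.
      by rewrite -powRM ?(ltW (divr_gt0 T0 x0)) ?(ltW x0)// divfK// gt_eqF.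
    by rewrite invfM mulrA divff ?mul1r ?powRN// gt_eqF// powR_gt0// divr_gt0.
  rewrite mulrAC ler_pdivrMr// (le_trans (GC _ _ _ xd)) ?divr_gt0//.
  by rewrite (le_trans (ler_norm _))// mulrC -ler_pdivrMr.
have T0 : 0 < T by exact: lt_le_trans T1.
have Tq0 : 0 < T `^ q / q by rewrite divr_gt0// powR_gt0.
(* The first bound serves the boundary term, at most [eta * T^(-p)]; the second serves the head, at
   most [eta * (T^q / q)]. *)
pose eta := Num.min (e / 3) (e / 3 / (T `^ q / q)).
have eta0 : 0 < eta by rewrite lt_min e3 divr_gt0.
have [d1 /= d10 rd1] : \forall s \near 0^'+, `|s `^ p * r s| <= eta.
  by move/cvgr0Pnorm_le : r0; exact.
have r_le (s : R) : 0 < s -> s < d1 -> `|r s| <= eta * s `^ (- p).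
  move=> s0 sd; rewrite powRN ler_pdivlMr ?powR_gt0//.
  have := rd1 s; rewrite /= sub0r normrN gtr0_norm// => /(_ sd s0).
  by rewrite normrM (ger0_norm (powR_ge0 _ _)) mulrC.
near=> x.
have Gx : x `^ (- p) * `|G (T / x) x| <= e / 3 by near: x; exact: near_G.
have x0 : 0 < x by near: x; apply: nbhs_pinfty_gt; rewrite num_real.
have xd : T / x < d1.
  rewrite ltr_pdivrMr// mulrC -ltr_pdivrMr//.
  by near: x; apply: nbhs_pinfty_gt; rewrite num_real.
pose u := T / x; have u0 : 0 < u by rewrite divr_gt0.
have xu : x * u = T by rewrite mulrC divfK// gt_eqF.
pose D : set (measurableTypeR R) := `]0, u]%classic.
have mD : measurable D by exact: measurable_itv.
have irD : mu.-integrable D (EFin \o r).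
  by apply: integrableS ir => //; apply: subset_itv; rewrite bnd_simp.
have irc : mu.-integrable `]0, +oo[ (EFin \o (fun t => r t * cos (x * t + phi))).
  exact: integrable_mul_cos.
have [ipow pow_le] := integral_powR_head q0 q1 u0.
have head : `|\int[mu]_(t in D) (r t * cos (x * t + phi))| <= eta * (u `^ q / q).
  apply: le_trans (norm_Rintegral_mul_cos x phi mD irD) _.
  apply: (@le_trans _ _ (\int[mu]_(t in D) (eta * t `^ (q - 1)))).
    apply: le_Rintegral => //.
    - by have := integrable_fun_norm mD irD.
    - exact: integrable_fun_scale.
    - move=> t; rewrite /D/= in_itv/= => /andP[t0 tu]; rewrite qp.
      by apply: r_le => //; exact: le_lt_trans xd.
  by rewrite RintegralZl// ler_pM2l.
rewrite -(subrK (\int[mu]_(t in D) (r t * cos (x * t + phi)))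
  (\int[mu]_(t in `]0, +oo[) (r t * cos (x * t + phi)))).
rewrite (@Rintegral_itvB R _ (BRight 0) (BInfty _ false) u irc) ?bnd_simp ?(ltW u0)//.
(* The factor [x] is consumed by the identity [tail]; [x^(-p)] remains as a weight on the boundary
   term and on [G]. *)
have xq : x `^ (1 - p) = x `^ (- p) * x.
  by rewrite -{3}(powRr1 (ltW x0)) -powRD ?gt_eqF ?implybT// addrC.
rewrite mulrDr {1}xq -[x `^ (- p) * x * _]mulrA tail//.
have -> : e = e / 3 + e / 3 + e / 3 by field.
have xp0 : 0 <= x `^ (- p) by exact: powR_ge0.
rewrite (le_trans (ler_normD _ _))// lerD//; last first.
  rewrite normrM (ger0_norm (powR_ge0 _ _)) (le_trans (ler_wpM2l (powR_ge0 _ _) head))//.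
  rewrite -/q mulrCA [x `^ q * _]mulrA -powRM ?(ltW x0) ?(ltW u0)// xu.
  by rewrite -ler_pdivlMr// /eta ge_min lexx orbT.
rewrite mulrDr (le_trans (ler_normD _ _))// lerD//; last first.
  by rewrite normrM normrN (ger0_norm xp0).
rewrite normrM normrN (ger0_norm xp0) normrM.
apply: (@le_trans _ _ (x `^ (- p) * (eta * u `^ (- p)))).
  rewrite ler_wpM2l//; apply: le_trans (r_le _ u0 xd).
  by rewrite ler_piMr// sin_max.
rewrite mulrCA -powRM ?(ltW x0) ?(ltW u0)// xu.
apply: (@le_trans _ _ (eta * 1)); last by rewrite mulr1 /eta ge_min lexx.
rewrite ler_pM2l// powRN invf_le1 ?powR_gt0//.
have : 1 `^ p <= T `^ p by apply: ge0_ler_powR; rewrite ?nnegrE// ltW.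
by rewrite powR1.
Unshelve. all: by end_near. Qed.

End oscillating_remainder.

(** * Tails of the derivative *)

Section tail_bounded.
Context {R : realType}.
Notation mu := (@lebesgue_measure R).
Implicit Types (f g h : R -> R) (p u x phi C d : R).

(** Integrability is included because [Rintegral] sends an infinite integral to the default value 0,
    for which the bound would say nothing. *)
Definition tail_bounded p g C d := forall u, 0 < u -> u < d ->
  mu.-integrable `]u, +oo[ (EFin \o g) /\
  u `^ p * \int[mu]_(t in `]u, +oo[) `|g t| <= C.

Lemma tail_bounded_integrable p g C d u : 0 < d -> tail_bounded p g C d -> 0 < u ->
  mu.-integrable `]u, +oo[ (EFin \o g).
Proof.
move=> d0 gb u0; pose v := Num.min u (d / 2).
have v0 : 0 < v by rewrite lt_min u0 divr_gt0.
have vd : v < d by rewrite gt_min; apply/orP; right; lra.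
have [ig _] := gb v v0 vd; apply: integrableS ig => //.
by apply: subset_itv; rewrite bnd_simp// ge_min lexx.
Qed.

Lemma tail_bounded_cos p g C d u x phi : 0 < d -> tail_bounded p g C d -> 0 < u -> u < d ->
  u `^ p * `|\int[mu]_(t in `]u, +oo[) (g t * cos (x * t + phi))| <= C.
Proof.
move=> d0 gb u0 ud; have [ig gC] := gb u u0 ud; apply: le_trans gC.
rewrite ler_wpM2l ?powR_ge0//; apply: norm_Rintegral_mul_cos => //.
Qed.

(** At [p = 0] the weight is 1 and the tails are bounded uniformly down to 0, so [g] is integrable
    on the whole half-line and Riemann-Lebesgue becomes available. *)
Lemma tail_bounded0_integrable g C d : 0 < d ->
  measurable_fun (`]0, +oo[%classic : set R) g -> tail_bounded 0 g C d ->
  mu.-integrable `]0, +oo[ (EFin \o g).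
Proof.
move=> d0 mg gb; apply: (@integrable_fun_le _ _ _ _ (fun t => `|g t|)) => //.
apply: (@integrable_of_bounded_integrals _ _ C).
- exact: measurableT_comp.
- by move=> t _; exact: normr_ge0.
move=> a b a0 ab; pose v := Num.min a (d / 2).
have v0 : 0 < v by rewrite lt_min a0 divr_gt0.
have vd : v < d by rewrite gt_min; apply/orP; right; lra.
have [ig gC] := gb v v0 vd.
have mV : measurable (`]v, +oo[%classic : set (measurableTypeR R)) by exact: measurable_itv.
have ing := integrable_fun_norm mV ig.
move: gC; rewrite powRr0 mul1r; rewrite -lee_fin; apply: le_trans.
rewrite /Rintegral fineK; last exact: integrable_fin_num ing.
apply: ge0_subset_integral => //; first exact: measurable_int ing.
by apply: subset_itv; rewrite bnd_simp// ge_min lexx.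
Qed.

(** The moving lower end is handled by subtraction: the full integral tends to 0 by
    Riemann-Lebesgue, and the head over []0, x^-1]] is small because the interval shrinks. *)
Lemma tail_bounded0_cos_cvg0 g C d phi : 0 < d ->
  measurable_fun (`]0, +oo[%classic : set R) g -> tail_bounded 0 g C d ->
  \int[mu]_(t in `]x^-1, +oo[) (g t * cos (x * t + phi)) @[x --> +oo] --> (0 : R).
Proof.
move=> d0 mg gb; have ig := tail_bounded0_integrable d0 mg gb.
apply/cvgr0Pnorm_le => e e0; have e2 : 0 < e / 2 by rewrite divr_gt0.
have [b b0 hb] := Rintegral_head_cvg0 ig e2.
have /cvgr0Pnorm_le/(_ _ e2) RL := riemann_lebesgue phi ig.
near=> x.
have x0 : 0 < x by near: x; apply: nbhs_pinfty_gt; rewrite num_real.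
have xV0 : 0 < x^-1 by rewrite invr_gt0.
have bx : b^-1 <= x by near: x; apply: nbhs_pinfty_ge; rewrite num_real.
have xb : x^-1 <= b by rewrite -(invrK b) lef_pV2// posrE invr_gt0.
have igc := integrable_mul_cos (measurable_itv _) x phi ig.
rewrite -(@Rintegral_itvB R _ (BRight 0) (BInfty _ false) x^-1 igc) ?bnd_simp ?(ltW xV0)//.
rewrite (le_trans (ler_normB _ _))// [leRHS]splitr lerD//.
  by near: x.
apply: le_trans (hb _ xV0 xb); apply: norm_Rintegral_mul_cos.
  exact: measurable_itv.
by apply: integrableS ig => //; apply: subset_itv; rewrite bnd_simp.
Unshelve. all: by end_near. Qed.

Lemma tail_bounded_rderiv f p C d : list_ac_pos f ->
  (forall u, 0 < u -> u < d ->
    ((u `^ p)%:E * \int[mu]_(t in `]u, +oo[) `|(derive1 f t)%:E| <= C%:E)%E) ->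
  tail_bounded p (rderiv f) C d.
Proof.
move=> acf fC u u0 ud.
have le_df := le_integral_rderiv_derive1 acf u0.
have up0 : 0 < u `^ p by exact: powR_gt0.
have le_C : ((u `^ p)%:E * \int[mu]_(t in `]u, +oo[) `|(rderiv f t)%:E| <= C%:E)%E.
  by apply: le_trans (fC _ u0 ud); rewrite lee_pmul2l.
have ir : mu.-integrable `]u, +oo[ (EFin \o rderiv f).
  apply/integrableP; split.
    apply/measurable_EFinP.
    apply: measurable_funS (measurable_rderiv (list_ac_pos_continuous acf)) => //.
    by apply: subset_itv; rewrite bnd_simp// ltW.
  rewrite ltNge leye_eq; apply/negP => /eqP E; move: le_C.
  by rewrite E gt0_muley ?lte_fin.
split => //.
rewrite -lee_fin EFinM; apply: le_trans le_C.
rewrite /Rintegral fineK//.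
have mU : measurable (`]u, +oo[%classic : set (measurableTypeR R)) by exact: measurable_itv.
exact: integrable_fin_num (integrable_fun_norm mU ir).
Qed.

Lemma list_ac_pos_gamma_density (a : R) : list_ac_pos (gamma_density a).
Proof.
apply: (@list_ac_pos_C1 _ _ (fun s => a * gamma_density (a - 1) s - gamma_density a s)).
  by move=> s s0; exact: is_derive_gamma_density.
move=> s s0; apply: cvgB; last exact: continuous_gamma_density.
by apply: cvgM; [exact: cvg_cst|exact: continuous_gamma_density].
Qed.

Lemma rderiv_gamma_density (a s : R) : 0 < s ->
  rderiv (gamma_density a) s = a * gamma_density (a - 1) s - gamma_density a s.
Proof.
move=> s0; have [d E] := is_derive_gamma_density a s0.
by rewrite rderivE// derive1E E.
Qed.

(** [m] is nonincreasing for [p >= 0], so its variation on []u, +oo[] is at most [m u], and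
    [u^p m(u) = e^(-u) <= 1]. *)
Lemma tail_bounded_gamma_density p d : 0 <= p ->
  tail_bounded p (rderiv (gamma_density (- p))) 1 d.
Proof.
move=> p0 u u0 _; set m := gamma_density (- p); set g := rderiv m.
have acm : list_ac_pos m by exact: list_ac_pos_gamma_density.
have g0 t : 0 < t -> g t <= 0.
  move=> t0; rewrite /g rderiv_gamma_density// subr_le0.
  rewrite (@le_trans _ _ 0) ?gamma_density_ge0//.
  by rewrite mulNr oppr_le0 mulr_ge0// gamma_density_ge0.
pose U : set (measurableTypeR R) := `]u, +oo[%classic.
have mU : measurable U by exact: measurable_itv.
have mg : measurable_fun (U : set R) g.
  apply: measurable_funS (measurable_rderiv (list_ac_pos_continuous acm)) => //.
  by apply: subset_itv; rewrite bnd_simp// ltW.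
have increment a b : 0 < a -> a <= b -> \int[mu]_(t in `]a, b]) (- g t) = m a - m b.
  move=> a0 ab; have [ig E] := rderiv_ftc acm a0 ab.
  have mab : measurable (`]a, b]%classic : set (measurableTypeR R)) by exact: measurable_itv.
  have := RintegralZl (-1) mab ig.
  rewrite {2}/Rintegral E/= mulN1r opprB => <-.
  by apply: eq_Rintegral => t _; rewrite mulN1r.
have m_le a : u < a -> m a <= m u.
  move=> ua; rewrite -subr_ge0 -increment ?(ltW ua)//; apply: Rintegral_ge0 => t.
  by rewrite /= in_itv/= => /andP[ut _]; rewrite oppr_ge0 g0// (lt_trans u0).
have ing : mu.-integrable U (EFin \o (fun t => - g t)).
  apply: (@integrable_of_bounded_integrals _ _ (m u)).
  - exact: measurableT_comp.
  - by move=> t ut; rewrite oppr_ge0 g0// (lt_trans u0).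
  move=> a b ua ab; have a0 := lt_trans u0 ua.
  have [ig _] := rderiv_ftc acm a0 (ltW ab).
  have mab : measurable (`]a, b]%classic : set (measurableTypeR R)) by exact: measurable_itv.
  have := increment a b a0 (ltW ab); rewrite /Rintegral => E.
  rewrite -(fineK (integrable_fin_num mab (integrable_fun_opp mab ig))) E lee_fin.
  by rewrite (le_trans _ (m_le _ ua))// lerBlDr lerDl gamma_density_ge0.
split.
  have := integrable_fun_opp mU ing; apply: eq_integrable => // t _ /=.
  by rewrite opprK.
have -> : \int[mu]_(t in U) `|g t| = \int[mu]_(t in U) (- g t).
  apply: eq_Rintegral => t; rewrite inE /U/= in_itv/= andbT => ut.
  by rewrite ler0_norm// g0// (lt_trans u0).
have : \int[mu]_(t in U) (- g t) <= m u.
  apply: Rintegral_le_of_bounded => // b ub; rewrite increment ?(ltW ub)//.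
  by rewrite lerBlDr lerDl gamma_density_ge0.
move=> /(ler_wpM2l (powR_ge0 u p)) /le_trans; apply.
rewrite /m /gamma_density powRN mulrA divff ?mul1r ?gt_eqF ?powR_gt0//.
by rewrite -expR0 ler_expR oppr_le0 ltW.
Qed.

End tail_bounded.

(** * Limits of the cosine integrals *)

Section oscillating_integral_limit.
Context {R : realType}.
Notation mu := (@lebesgue_measure R).
Implicit Types (f : R -> R) (p q l x phi C d K : R).

Lemma gamma_cos_0_cvg q : 0 < q -> q <= 1 ->
  x `^ q * gamma_cos (q - 1) x 0 @[x --> +oo] --> Gamma q * cos (q * (pi / 2)).
Proof.
move=> q0 q1.
have -> : (fun x => x `^ q * gamma_cos (q - 1) x 0) =
    (fun x => x `^ q * (1 + x ^+ 2) `^ (- (q / 2)) * (Gamma q * cos (q * atan x))).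
  by apply/funext => x; rewrite gamma_cos_0//; ring.
rewrite -[X in _ --> X]mul1r; apply: cvgM; first exact: powR_ratio_cvg1.
apply: cvgM; first exact: cvg_cst.
apply: (cvg_comp (fun x => q * atan x) cos); last exact: continuous_cos.
by apply: cvgM; [exact: cvg_cst|exact: cvgy_atan].
Qed.

Lemma gamma_cos_pihalf_cvg q : 0 < q -> q <= 1 ->
  x `^ q * gamma_cos (q - 1) x (pi / 2) @[x --> +oo] -->
  - (Gamma q * sin (q * (pi / 2))).
Proof.
move=> q0 q1.
have -> : (fun x => x `^ q * gamma_cos (q - 1) x (pi / 2)) =
    (fun x => x `^ q * (1 + x ^+ 2) `^ (- (q / 2)) * - (Gamma q * sin (q * atan x))).
  by apply/funext => x; rewrite gamma_cos_pihalf//; ring.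
rewrite -[X in _ --> X]mul1r; apply: cvgM; first exact: powR_ratio_cvg1.
apply: cvgN; apply: cvgM; first exact: cvg_cst.
apply: (cvg_comp (fun x => q * atan x) sin); last exact: continuous_sin.
by apply: cvgM; [exact: cvg_cst|exact: cvgy_atan].
Qed.

(** [K] is the limit for the model, kept abstract so that the real and imaginary parts share one
    argument. *)
Lemma oscillating_integral_cvg f p l C d phi K :
  list_ac_pos f -> mu.-integrable `]0, +oo[ (EFin \o f) ->
  0 <= p -> p < 1 -> s `^ p * f s @[s --> 0^'+] --> l ->
  0 < d -> tail_bounded p (rderiv f) C d ->
  x `^ (1 - p) * gamma_cos (1 - p - 1) x phi @[x --> +oo] --> K ->
  x `^ (1 - p) * \int[mu]_(t in `]0, +oo[) (f t * cos (x * t + phi))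
    @[x --> +oo] --> l * K.
Proof.
move=> acf if_ p0 p1 fl d0 tbf HK.
pose D : set (measurableTypeR R) := `]0, +oo[%classic.
have mD : measurable D by exact: measurable_itv.
have qp : 1 - p - 1 = - p by rewrite addrAC subrr add0r.
pose m := gamma_density (- p).
have acm : list_ac_pos m by exact: list_ac_pos_gamma_density.
have im : mu.-integrable D (EFin \o m).
  by rewrite /m -qp; apply: integrable_gamma_density; rewrite ?subr_gt0 ?gerBl.
have tbm : tail_bounded p (rderiv m) 1 d by exact: tail_bounded_gamma_density.
pose r t := f t - l * m t.
pose psi := phi - pi / 2.
pose G h u x := \int[mu]_(t in `]u, +oo[) (rderiv h t * cos (x * t + psi)).
have ilm := integrable_fun_scale mD l im.
have ir : mu.-integrable D (EFin \o r) by exact: integrable_fun_sub.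
have r0 : s `^ p * r s @[s --> 0^'+] --> (0 : R).
  have e1 : expR (- s) @[s --> 0^'+] --> (1 : R).
    rewrite -[X in _ --> X](_ : expR (- 0) = 1); last by rewrite oppr0 expR0.
    apply: cvg_at_right_filter.
    exact: (is_derive1_continuous (is_derive1_expRN 0)).
  rewrite -[X in _ --> X](_ : l - l * 1 = 0); last by rewrite mulr1 subrr.
  have : s `^ p * f s - l * expR (- s) @[s --> 0^'+] --> l - l * 1.
    by apply: cvgB => //; apply: cvgM => //; exact: cvg_cst.
  apply: cvg_trans; apply: near_eq_cvg; near=> s.
  have s0 : 0 < s by [].
  rewrite /r /m /gamma_density powRN mulrBr mulrCA [s `^ p * (_ * _)]mulrA.
  by rewrite divff ?mul1r// gt_eqF// powR_gt0.
have mcos0 h a x c : mu.-integrable `]a, +oo[ (EFin \o h) -> mu.-integrable `]a, +oo[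
    (EFin \o (fun t => h t * cos (x * t + c))).
  by apply: integrable_mul_cos; exact: measurable_itv.
have tail u x : 0 < u -> 0 < x ->
    x * \int[mu]_(t in `]u, +oo[) (r t * cos (x * t + phi)) =
    - (r u * sin (x * u + phi)) - (G f u x - l * G m u x).
  move=> u0 x0; pose U : set (measurableTypeR R) := `]u, +oo[%classic.
  have mU : measurable U by exact: measurable_itv.
  have UD : U `<=` D by apply: subset_itv; rewrite bnd_simp// ltW.
  have ifU : mu.-integrable U (EFin \o f) by exact: integrableS if_.
  have imU : mu.-integrable U (EFin \o m) by exact: integrableS im.
  have Ef := ac_tail_by_parts_cos phi acf if_ u0 x0 (tail_bounded_integrable d0 tbf u0).
  have Em := ac_tail_by_parts_cos phi acm im u0 x0 (tail_bounded_integrable d0 tbm u0).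
  have -> : \int[mu]_(t in U) (r t * cos (x * t + phi)) =
      \int[mu]_(t in U) (f t * cos (x * t + phi))
      - l * \int[mu]_(t in U) (m t * cos (x * t + phi)).
    rewrite -RintegralZl//; last exact: integrable_mul_cos.
    rewrite -RintegralB//; last 2 first.
    - exact: integrable_mul_cos.
    - by apply: integrable_fun_scale => //; exact: integrable_mul_cos.
    by apply: eq_Rintegral => t _; rewrite /r; ring.
  rewrite mulrBr Ef mulrCA Em /r -/psi -/(G f u x) -/(G m u x); ring.
(* The constant adds the tail bound [C] of [f] and [|l|] times the tail bound 1 of the model. *)
have GC u x : 0 < u -> u < d -> u `^ p * `|G f u x - l * G m u x| <= C + `|l|.
  move=> u0 ud.
  have Cf := tail_bounded_cos x psi d0 tbf u0 ud.
  have Cm := tail_bounded_cos x psi d0 tbm u0 ud.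
  apply: (@le_trans _ _ (u `^ p * `|G f u x| + `|l| * (u `^ p * `|G m u x|))).
    rewrite [`|l| * _]mulrCA -mulrDr -normrM ler_wpM2l ?powR_ge0//.
    exact: ler_normB.
  by rewrite lerD// -[leRHS]mulr1 ler_wpM2l.
have G0 : p = 0 -> (fun u x => G f u x - l * G m u x) x^-1 x @[x --> +oo] --> (0 : R).
  move=> p_eq0; rewrite p_eq0 in tbf tbm.
  have mrd h : list_ac_pos h -> measurable_fun (`]0, +oo[%classic : set R) (rderiv h).
    by move=> ach; apply: measurable_rderiv; exact: list_ac_pos_continuous.
  rewrite -[X in _ --> X](_ : 0 - l * 0 = 0); last by rewrite mulr0 subr0.
  apply: cvgB; first exact: (tail_bounded0_cos_cvg0 psi d0 (mrd f acf) tbf).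
  apply: cvgM; first exact: cvg_cst.
  exact: (tail_bounded0_cos_cvg0 psi d0 (mrd m acm) tbm).
have rem := oscillating_remainder_cvg0 p0 p1 ir r0 tail d0 GC G0.
rewrite -[X in _ --> X](_ : 0 + l * K = l * K); last by rewrite add0r.
have : x `^ (1 - p) * \int[mu]_(t in D) (r t * cos (x * t + phi)) +
    l * (x `^ (1 - p) * gamma_cos (1 - p - 1) x phi) @[x --> +oo] --> 0 + l * K.
  by apply: cvgD => //; apply: cvgM => //; exact: cvg_cst.
apply: cvg_trans; apply: near_eq_cvg; apply: nearW => x.
rewrite qp /gamma_cos -/m mulrCA -mulrDr; congr (_ * _).
rewrite -RintegralZl//; last exact: integrable_mul_cos.
rewrite -RintegralD//; last 2 first.
- exact: integrable_mul_cos.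
- by apply: integrable_fun_scale => //; exact: integrable_mul_cos.
by apply: eq_Rintegral => t _; rewrite /r -/(m t); ring.
Unshelve. all: by end_near. Qed.

End oscillating_integral_limit.

(** * Complex form *)

Local Open Scope complex_scope.

Section complex_packaging.
Context {R : realType}.
Implicit Types (f : R -> R) (a b s x : R).

Lemma cvg_complex (T : Type) (F : set_system T) (FF : Filter F) (A B : T -> R) (a b : R) :
  A @ F --> a -> B @ F --> b ->
  ((A t +i* B t : R[i]^o) @[t --> F] --> (a +i* b : R[i]^o)).
Proof.
(* The radius [e] is itself a complex number; [0 < e] forces its imaginary part to be 0. *)
move=> /cvgrPdist_lt cA /cvgrPdist_lt cB; apply/cvgrPdist_lt => e.
case: e => e1 e2; rewrite ltcE/= => /andP[/eqP -> e0].
have e20 : 0 < e1 / 2 by rewrite divr_gt0.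
apply: (filterS _ (filterI (cA _ e20) (cB _ e20))) => t [/= At Bt].
have -> : (a +i* b - (A t +i* B t) : R[i]) = (a - A t)%:C + 'i * (b - B t)%:C.
  by simpc.
apply: le_lt_trans (ler_normD _ _) _.
have -> : `|(a - A t)%:C| = `|a - A t|%:C :> R[i].
  by rewrite normc_def/= expr0n addr0 sqrtr_sqr.
have -> : `|'i * (b - B t)%:C| = `|b - B t|%:C :> R[i].
  by rewrite normc_def/=; simpc; rewrite expr0n add0r sqrtr_sqr.
rewrite complexr0 -(rmorphD (real_complex R)) ltcR [ltRHS]splitr; exact: ltrD.
Qed.

Lemma cexp_imaginary (x : R) : cexp ('i * x%:C) = cos x +i* sin x.
Proof. by rewrite /cexp; simpc; rewrite /= expR0; simpc. Qed.

Lemma half_fourierE f x : half_fourier f x =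
  (\int[@lebesgue_measure R]_(s in `]0, +oo[) (f s * cos (x * s + 0))) +i*
  (\int[@lebesgue_measure R]_(s in `]0, +oo[) (f s * cos (x * s + pi / 2))).
Proof.
have E s : cexp (- ('i * x%:C * s%:C)) * (f s)%:C =
    (f s * cos (x * s + 0)) +i* (f s * cos (x * s + pi / 2)).
  have -> : - ('i * x%:C * s%:C) = 'i * (- (x * s))%:C :> R[i] by simpc.
  by rewrite cexp_imaginary cosN sinN addr0 cosDpihalf; simpc; congr (_ +i* _); ring.
rewrite /half_fourier /Cintegral; congr (_ +i* _);
  by apply: eq_Rintegral => s _; rewrite E.
Qed.

(** [- i e^(i p pi / 2)] equals [e^(- i (1 - p) pi / 2)], the limiting phase found for the model. *)
Lemma nfrakE (p : R) : nfrak p =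
  (Gamma (1 - p) * cos ((1 - p) * (pi / 2))) +i*
  (- (Gamma (1 - p) * sin ((1 - p) * (pi / 2)))).
Proof.
have E : (1 - p) * (pi / 2) = pi / 2 - p * (pi / 2) :> R by ring.
have -> : cos ((1 - p) * (pi / 2)) = sin (p * (pi / 2)).
  by rewrite E -opprB cosN cosBpihalf.
have -> : sin ((1 - p) * (pi / 2)) = cos (p * (pi / 2)).
  by rewrite E sinB cos_pihalf sin_pihalf mul1r mul0r subr0.
rewrite /nfrak.
have -> : 'i * p%:C * pi%:C / 2 = 'i * (p * (pi / 2))%:C :> R[i].
  rewrite -!mulrA !rmorphM fmorphV rmorph_nat; ring.
by rewrite cexp_imaginary; simpc; congr (_ +i* _); ring.
Qed.

End complex_packaging.

Lemma limf_esup_lty_near (R : realType) (F : R -> \bar R) :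
  (limf_esup F (0 : R)^'+ < +oo)%E ->
  exists C, exists2 d, 0 < d & forall u, 0 < u -> u < d -> (F u <= C%:E)%E.
Proof.
move=> /ereal_inf_lt[_ [A [d /= d0 dA] <-]] supA.
(* The maximum with 0 excludes the value [-oo], so that [fine] loses nothing. *)
exists (fine (Order.max (ereal_sup (F @` A)) 0%E)), d => // u u0 ud.
rewrite fineK; last first.
  rewrite fin_numElt lt_max ltNy0 orbT/=.
  by rewrite gt_max supA ltry.
rewrite le_max; apply/orP; left; apply: ereal_sup_ubound; exists u => //.
by apply: dA => //=; rewrite sub0r normrN gtr0_norm.
Qed.

(* R[i]^o carries the topology of the modulus on R[i]. *)
Theorem theorem1 (R : realType) (f : R -> R) (p l : R)
  (f_L1 : (@lebesgue_measure R).-integrable `]0, +oo[ (fun s : R => (f s)%:E))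
  (f_ac : loc_abs_continuous_pos f)
  (df_L1 : exists2 M : R, 0 < M &
     (@lebesgue_measure R).-integrable `]M, +oo[ (fun s : R => (derive1 f s)%:E))
  (p_ge0 : 0 <= p) (p_lt1 : p < 1)
  (f_lim : s `^ p * f s @[s --> 0^'+] --> l)
  (df_limsup : (limf_esup
     (fun x : R => (x `^ p)%:E
        * \int[@lebesgue_measure R]_(s in `]x, +oo[) `|(derive1 f s)%:E|)
     (0 : R)^'+ < +oo)%E) :
  ((lambda `^ (1 - p))%:C * half_fourier f lambda : R[i]^o)
    @[lambda --> +oo] --> (l%:C * nfrak p : R[i]^o).

Proof.
have acf : list_ac_pos f.
  by move=> a b a0 ab; apply: abs_continuous_on_list_ac; exact: f_ac.
have [C [d d0 dC]] := limf_esup_lty_near df_limsup.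
have tbf := tail_bounded_rderiv acf dC.
have q0 : 0 < 1 - p by rewrite subr_gt0.
have q1 : 1 - p <= 1 by rewrite gerBl.
have re := oscillating_integral_cvg acf f_L1 p_ge0 p_lt1 f_lim d0 tbf (gamma_cos_0_cvg q0 q1).
have im := oscillating_integral_cvg acf f_L1 p_ge0 p_lt1 f_lim d0 tbf (gamma_cos_pihalf_cvg q0 q1).
have -> : l%:C * nfrak p = (l * (Gamma (1 - p) * cos ((1 - p) * (pi / 2)))) +i*
    (l * - (Gamma (1 - p) * sin ((1 - p) * (pi / 2)))).
  by rewrite nfrakE; simpc.
rewrite (_ : (fun x => _) = (fun x =>
    (x `^ (1 - p) * \int[lebesgue_measure]_(t in `]0, +oo[) (f t * cos (x * t + 0))) +i*
    (x `^ (1 - p) * \int[lebesgue_measure]_(t in `]0, +oo[) (f t * cos (x * t + pi / 2))))).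
  exact: cvg_complex.
by apply/funext => x; rewrite half_fourierE; simpc.
Qed.
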